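(* Let $\{\mathcal{I},F,\{f_i\}_{i=1}^N,\{\Delta_i\}_{i=1}^N\}$ be the branching function system associated to a slow continued fraction algorithm and $\pi_F$ the associated permutative representation of $\mathcal{O}_N$ on $\ell^2(\mathcal{I})$. Then the irreducible decomposition of $\pi_F$ is given as $$\ell^2(\mathcal{I})=\bigoplus_{[x]_F\in\mathcal{I}/\sim_F}\mathcal{H}_{[x]_F},$$ where $\mathcal{H}_{[x]_F}$ is the (closed) subspace of $\ell^2(\mathcal{I})$ with orthonormal basis $\{e_y:y\sim_Fx\}$.
   Context: $\mathcal{O}_N$ ($2\le N<\infty$) is the universal $C^*$-algebra generated by $S_1,\dots,S_N$ with $S_i^*S_j=\delta_{ij}1$, $\sum_{i=1}^N S_iS_i^*=1$. A representation is irreducible if its only closed invariant subspaces are $\{0\}$ and the whole space. A branching function system (BFS) of order $N$ on a set $\Omega$ is a family of injective maps $f_i:\Omega\to\Omega$ ($1\le i\le N$) with pairwise disjoint ranges $\Delta_i=f_i(\Omega)$ whose union is $\Omega$; $F$ is the map equal to $f_i^{-1}$ on $\Delta_i$. It induces a permutative representation $\pi_F$ of $\mathcal{O}_N$ on $\ell^2(\Omega)$ (orthonormal basis $\{e_\omega:\omega\in\Omega\}$) by $\pi_F(S_i)e_\omega=e_{f_i(\omega)}$. $\mathrm{PGL}_2(\mathbb{Z})$ is the group of $2\times2$ integer matrices of determinant $\pm1$ modulo $\pm$ identity, viewed as fractional linear transformations. A unimodular interval is $[\frac pq,\frac{p'}{q'}]\subset[0,1]$ with reduced fractions satisfying $pq'-p'q=-1$.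 A unimodular partition is a finite collection of unimodular intervals with union $[0,1]$, any two of which meet in at most one point. A slow continued fraction algorithm (SCFA) is a finite collection $h_1,\dots,h_N:[0,1]\to[0,1]$ ($N\ge2$) of fractional linear transformations in $\mathrm{PGL}_2(\mathbb{Z})$ whose images $h_i([0,1])$ form a unimodular partition, indexed from left to right. Let $\mathcal{I}=[0,1]\setminus\mathbb{Q}$; the BFS associated to the SCFA is the BFS on $\mathcal{I}$ formed by the restrictions $f_i=h_i|_{\mathcal{I}}$. A sequence $(x_n)\in\{1,\dots,N\}^{\mathbb{N}}$ is an $F$-itinerary of $x\in[0,1]$ if $x\in\bigcap_{n\ge1}h_{x_1}\circ h_{x_2}\circ\cdots\circ h_{x_n}([0,1])$. Sequences $(x_n),(y_n)$ are tail equivalent if there are $z\in\mathbb{Z}$, $m\in\mathbb{N}$ with $x_{n+z}=y_n$ for all $n\ge m$. Write $x\sim_Fy$ if there exist tail equivalent $F$-itineraries for $x$ and $y$; this is an equivalence relation, with classes $[x]_F$. *)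

(* Defs.v *)
From HB Require Import structures.
From mathcomp Require Import all_boot all_order all_algebra.
From mathcomp Require Import finmap ring lra.
From mathcomp Require Import boolp classical_sets functions cardinality fsbigop.
From mathcomp Require Import reals ereal topology normedtype esum numfun.
From mathcomp Require Import complex.
Set Implicit Arguments.
Unset Strict Implicit.
Unset Printing Implicit Defensive.
Import Order.TTheory GRing.Theory Num.Theory numFieldNormedType.Exports.
Import complex.
Local Open Scope classical_set_scope.
Local Open Scope ring_scope.
Local Open Scope complex_scope.

(* Hilbert spaces over R[i]; [inner] is linear in its first argument. *)
HB.mixin Record isHilbert (R : realType) V & CompleteNormedModule R[i] V := {
  inner : {dot V for @Num.conj R[i]};
  innerE : forall x : V, inner x x = `|x| ^+ 2 }.
#[short(type="hilbertType")]
HB.structure Definition Hilbert (R : realType) :=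
  {V of isHilbert R V & CompleteNormedModule R[i] V}.

(* |z|^2 as an element of R; the library's [`|z|] is an element of R[i]. *)
Definition sqmod (R : realType) (z : R[i]) : R := Re z ^+ 2 + Im z ^+ 2.

Definition sqnorm (R : realType) (T : choiceType) (f : T -> R[i]) : \bar R :=
  (\esum_(w in [set: T]) (sqmod (f w))%:E)%E.

Definition square_summable (R : realType) (T : choiceType) (f : T -> R[i]) :=
  (sqnorm f < +oo)%E.

(* Sums of absolutely summable families, of reals and of complex numbers. *)
Definition rsum (R : realType) (T : choiceType) (a : T -> R) : R :=
  fine (\esum_(w in [set: T]) (EFin \o a)^\+ w
        - \esum_(w in [set: T]) (EFin \o a)^\- w)%E.

Definition csum (R : realType) (T : choiceType) (a : T -> R[i]) : R[i] :=
  rsum (fun w => Re (a w)) +i* rsum (fun w => Im (a w)).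

Section sums.
Context {R : realType} {T : choiceType}.
Implicit Types (a b p q : T -> R) (f g : T -> R[i]) (z : R[i]).

Lemma sqmod_ge0 z : 0 <= sqmod z.
Proof. by rewrite addr_ge0 ?sqr_ge0. Qed.

Lemma sqmod_normE z : (sqmod z)%:C = `|z| ^+ 2.
Proof. exact: add_Re2_Im2. Qed.

Lemma sqmodM z w : sqmod (z * w) = sqmod z * sqmod w.
Proof. by case: z w => [a b] [c d]; rewrite /sqmod /=; ring. Qed.

Lemma esum_cvgZ (k : R) a : 0 <= k -> (forall w, 0 <= a w) ->
  (\esum_(w in [set: T]) (k * a w)%:E = k%:E * \esum_(w in [set: T]) (a w)%:E)%E.
Proof.
move=> k0 a0; have le : forall (c : R) b, 0 <= c -> (forall w, 0 <= b w) ->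
  (\esum_(w in [set: T]) (c * b w)%:E <= c%:E * \esum_(w in [set: T]) (b w)%:E)%E.
  move=> c b c0 b0; apply: ge_ereal_sup => _ [X [fX _] <-].
  under eq_fsbigr do rewrite EFinM.
  rewrite -ge0_mule_fsumr //; apply: lee_wpmul2l; rewrite ?lee_fin//.
  by apply: ereal_sup_ubound; exists X.
apply/eqP; rewrite eq_le le//=.
have [->|kn0] := eqVneq k 0.
  by rewrite mul0e; apply: esum_ge0 => w _; rewrite mul0r.
have kp : 0 < k by rewrite lt_def kn0.
have kV : 0 <= k^-1 by rewrite invr_ge0.
have := le k^-1 (fun w => k * a w) kV (fun w => mulr_ge0 k0 (a0 w)).
under eq_esum => w _ do rewrite mulKf//.
move=> /(@lee_wpmul2l _ k%:E); rewrite lee_fin => /(_ k0).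
by rewrite muleA -EFinM divff// mul1e.
Qed.

Definition abs_summable a := (\esum_(w in [set: T]) (`|a w|)%:E < +oo)%E.

Lemma smP a : abs_summable a -> summable [set: T] (EFin \o a).
Proof. by []. Qed.

Lemma sm_fin a : abs_summable a -> (forall w, 0 <= a w) ->
  (\esum_(w in [set: T]) (a w)%:E)%E \is a fin_num.
Proof.
move=> sa a0; have := sa; rewrite -[abs_summable a]/(summable setT (EFin \o a)) summableE.
by under eq_esum => w _ do rewrite /= ger0_norm//.
Qed.

Lemma sm_le a b : (forall w, `|a w| <= `|b w|) -> abs_summable b -> abs_summable a.
Proof.
move=> h; apply: le_lt_trans; apply: le_esum => w _; by rewrite lee_fin.
Qed.

Lemma smD a b : abs_summable a -> abs_summable b -> abs_summable (fun w => a w + b w).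
Proof. by move=> ha hb; have := summableD (smP ha) (smP hb). Qed.

Lemma smZ k a : abs_summable a -> abs_summable (fun w => k * a w).
Proof.
move=> ha; rewrite /abs_summable.
under eq_esum => w _ do rewrite normrM.
rewrite esum_cvgZ //.
have : (\esum_(w in [set: T]) (`|a w|)%:E)%E \is a fin_num.
  by apply: sm_fin => //; apply: sm_le ha => w; rewrite normr_id.
by move/fineK <-; rewrite -EFinM ltry.
Qed.

Lemma rsumB p q : abs_summable p -> abs_summable q -> (forall w, 0 <= p w) -> (forall w, 0 <= q w) ->
  rsum (fun w => p w - q w) =
  fine (\esum_(w in [set: T]) (p w)%:E) - fine (\esum_(w in [set: T]) (q w)%:E).
Proof.
move=> sp sq p0 q0; rewrite /rsum.
have := @esumB R T setT _ _ (smP sp) (smP sq) (fun w _ => p0 w) (fun w _ => q0 w).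
rewrite /= => ->.
by rewrite fineB ?sm_fin.
Qed.

Let ps a w := (`|a w| + a w) / 2.
Let ng a w := (`|a w| - a w) / 2.

Lemma ps_ge0 a w : 0 <= ps a w.
Proof. by rewrite /ps; have := ler_norm (- a w); rewrite normrN; lra. Qed.
Lemma ng_ge0 a w : 0 <= ng a w.
Proof. by rewrite divr_ge0// subr_ge0 ler_norm. Qed.
Lemma psng a w : a w = ps a w - ng a w.
Proof. by rewrite /ps /ng; field. Qed.
Lemma sm_ps a : abs_summable a -> abs_summable (ps a).
Proof.
apply: sm_le => w; rewrite ger0_norm ?ps_ge0// /ps.
by have := ler_norm (a w); lra.
Qed.
Lemma sm_ng a : abs_summable a -> abs_summable (ng a).
Proof.
apply: sm_le => w; rewrite ger0_norm ?ng_ge0// /ng.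
by have := ler_norm (- a w); rewrite normrN; lra.
Qed.

Let fs a := fine (\esum_(w in [set: T]) (a w)%:E).

Lemma fsD p q : abs_summable p -> abs_summable q -> (forall w, 0 <= p w) -> (forall w, 0 <= q w) ->
  fs (fun w => p w + q w) = fs p + fs q.
Proof.
move=> sp sq p0 q0; rewrite /fs.
under eq_esum do rewrite EFinD.
rewrite esumD ?fineD// => [||w _|w _]; rewrite ?lee_fin//.
  exact: sm_fin.
exact: sm_fin.
Qed.

Lemma rsumE a : abs_summable a -> rsum a = fs (ps a) - fs (ng a).
Proof.
move=> sa; rewrite -rsumB ?sm_ps ?sm_ng//; try exact: ps_ge0; try exact: ng_ge0.
by congr rsum; apply/funext => w; rewrite -psng.
Qed.

Lemma rsumD a b : abs_summable a -> abs_summable b ->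
  rsum (fun w => a w + b w) = rsum a + rsum b.
Proof.
move=> sa sb.
have -> : (fun w => a w + b w) =
    (fun w => (ps a w + ps b w) - (ng a w + ng b w)).
  by apply/funext => w; rewrite {1}(psng a) {1}(psng b); ring.
have [[[pa na] pb] nb] := (sm_ps sa, sm_ng sa, sm_ps sb, sm_ng sb).
rewrite rsumB; first last.
- by move=> w; rewrite addr_ge0 ?ng_ge0.
- by move=> w; rewrite addr_ge0 ?ps_ge0.
- exact: smD.
- exact: smD.
rewrite -!/(fs _) !fsD//; try exact: ps_ge0; try exact: ng_ge0.
by rewrite !rsumE//; ring.
Qed.

Lemma rsumN a : abs_summable a -> rsum (fun w => - a w) = - rsum a.
Proof.
move=> sa; rewrite (rsumE sa) opprB -rsumB ?sm_ps ?sm_ng//; try exact: ps_ge0; try exact: ng_ge0.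
by congr rsum; apply/funext => w; rewrite {1}(psng a); ring.
Qed.

Lemma rsumZ k a : abs_summable a -> rsum (fun w => k * a w) = k * rsum a.
Proof.
have main c : 0 <= c -> abs_summable a -> rsum (fun w => c * a w) = c * rsum a.
  move=> c0 sa.
  have -> : (fun w => c * a w) = (fun w => c * ps a w - c * ng a w).
    by apply/funext => w; rewrite {1}(psng a); ring.
  rewrite rsumB ?(smZ _ (sm_ps sa)) ?(smZ _ (sm_ng sa))//; first last.
  - by move=> w; rewrite mulr_ge0 ?ng_ge0.
  - by move=> w; rewrite mulr_ge0 ?ps_ge0.
  rewrite !esum_cvgZ//; try exact: ps_ge0; try exact: ng_ge0.
  rewrite rsumE// mulrBr /fs.
  have fp := sm_fin (sm_ps sa) (ps_ge0 a).
  have fn := sm_fin (sm_ng sa) (ng_ge0 a).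
  by rewrite (fineM (x := c%:E)%E) // (fineM (x := c%:E)%E) //.
move=> sa; have [k0|/ltW k0] := leP 0 k; first exact: main.
have -> : (fun w => k * a w) = (fun w => - (- k * a w)).
  by apply/funext => w; ring.
rewrite rsumN ?main ?oppr_ge0//; first by rewrite mulNr opprK.
exact: smZ.
Qed.

Definition abs_csummable f := abs_summable (fun w => Re (f w)) /\ abs_summable (fun w => Im (f w)).

Lemma cext (x y : R[i]) : Re x = Re y -> Im x = Im y -> x = y.
Proof. by case: x y => ? ? [? ?] /= -> ->. Qed.

Lemma csumD f g : abs_csummable f -> abs_csummable g -> csum (fun w => f w + g w) = csum f + csum g.
Proof.
move=> [f1 f2] [g1 g2]; apply: cext => /=; rewrite -!rsumD//.
  by congr rsum; apply/funext => w; case: (f w) (g w) => ? ? [].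
by congr rsum; apply/funext => w; case: (f w) (g w) => ? ? [].
Qed.

Lemma csmD f g : abs_csummable f -> abs_csummable g -> abs_csummable (fun w => f w + g w).
Proof.
move=> [f1 f2] [g1 g2]; split.
  have := smD f1 g1; congr abs_summable; apply/funext => w; by case: (f w) (g w) => ? ? [].
have := smD f2 g2; congr abs_summable; apply/funext => w; by case: (f w) (g w) => ? ? [].
Qed.

Lemma csumZ z f : abs_csummable f -> csum (fun w => z * f w) = z * csum f.
Proof.
move=> [f1 f2]; case: z => x y; apply: cext => /=.
  have s2 : abs_summable (fun w => - (y * Im (f w))).
    by have := smZ (- y) f2; congr abs_summable; apply/funext => w; rewrite mulNr.
  rewrite -(rsumZ x f1) -(rsumZ y f2) -(rsumN (smZ y f2)) -(rsumD (smZ x f1) s2).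
  by congr rsum; apply/funext => w; case: (f w).
rewrite -(rsumZ x f2) -(rsumZ y f1) -(rsumD (smZ x f2) (smZ y f1)).
by congr rsum; apply/funext => w; case: (f w).
Qed.

Lemma csum_conj f : abs_csummable f -> csum (fun w => (f w)^*%C) = (csum f)^*%C.
Proof.
move=> [f1 f2]; rewrite /csum /= -rsumN//.
by congr (_ +i* _); congr rsum; apply/funext => w; case: (f w).
Qed.

Lemma summable_prod f g : square_summable f -> square_summable g ->
  abs_csummable (fun w => f w * (g w)^*%C).
Proof.
rewrite /square_summable /sqnorm => sf sg.
have s2 : abs_summable (fun w => sqmod (f w) + sqmod (g w)).
  apply: smD; rewrite /abs_summable.
    by under eq_esum => w _ do rewrite ger0_norm ?sqmod_ge0//.
  by under eq_esum => w _ do rewrite ger0_norm ?sqmod_ge0//.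
split; apply: (sm_le _ s2) => w; rewrite (ger0_norm (addr_ge0 (sqmod_ge0 _) (sqmod_ge0 _)));
  case: (f w) (g w) => a b [c d]; rewrite /sqmod/=; apply/ler_normlP; split.
- by have := sqr_ge0 (a + c); have := sqr_ge0 (b + d); have := sqr_ge0 (a - c); have := sqr_ge0 (b - d); nra.
- by have := sqr_ge0 (a + c); have := sqr_ge0 (b + d); have := sqr_ge0 (a - c); have := sqr_ge0 (b - d); nra.
- by have := sqr_ge0 (a + d); have := sqr_ge0 (b + c); have := sqr_ge0 (a - d); have := sqr_ge0 (b - c); nra.
- by have := sqr_ge0 (a + d); have := sqr_ge0 (b + c); have := sqr_ge0 (a - d); have := sqr_ge0 (b - c); nra.
Qed.
End sums.

Section ell2_sub.
Context {R : realType} {T : choiceType}.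
Implicit Types (f g : T -> R[i]).

Lemma sqnorm_ge0 f : (0 <= sqnorm f)%E.
Proof. by apply: esum_ge0 => w _; rewrite lee_fin sqmod_ge0. Qed.

Lemma sqnormZ (z : R[i]) f : (sqnorm (fun w => z * f w)%R = (sqmod z)%:E * sqnorm f)%E.
Proof.
rewrite /sqnorm -esum_cvgZ ?sqmod_ge0// => [|w]; last exact: sqmod_ge0.
by apply: eq_esum => w _; rewrite sqmodM.
Qed.

Lemma sqmodD_le (s : R) (x y : R[i]) : 0 < s ->
  sqmod (x + y) <= (1 + s) * sqmod x + (1 + s^-1) * sqmod y.
Proof.
move=> s0; case: x y => a b [c d]; rewrite /sqmod /=.
have H (u v : R) : (u + v) ^+ 2 <= (1 + s) * u ^+ 2 + (1 + s^-1) * v ^+ 2.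
  have -> : (1 + s) * u ^+ 2 + (1 + s^-1) * v ^+ 2 =
     (u + v) ^+ 2 + s^-1 * (s * u - v) ^+ 2.
    by field; rewrite gt_eqF.
  by rewrite lerDl mulr_ge0 ?sqr_ge0 ?invr_ge0 ?ltW.
by have := H a c; have := H b d; lra.
Qed.

Lemma sqnormD_le (s : R) f g : 0 < s ->
  (sqnorm (fun w => f w + g w)%R <=
     (1 + s)%:E * sqnorm f + (1 + s^-1)%:E * sqnorm g)%E.
Proof.
move=> s0; have s1 : 0 <= 1 + s by rewrite addr_ge0 ?ltW.
have s2 : 0 <= 1 + s^-1 by rewrite addr_ge0 ?invr_ge0 ?ltW.
rewrite /sqnorm -!esum_cvgZ//; try by move=> w; exact: sqmod_ge0.
rewrite -esumD => [|w _|w _]; rewrite ?lee_fin ?mulr_ge0 ?sqmod_ge0//.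
apply: le_esum => w _; rewrite -EFinD lee_fin; exact: sqmodD_le.
Qed.

Lemma square_summable_submod : submod_closed (@square_summable R T).
Proof.
split=> [|z f g].
  rewrite /square_summable unfold_in /sqnorm esum1 ?ltry// => w _.
  by rewrite /sqmod /= expr0n addr0.
rewrite !unfold_in /square_summable => sf sg.
apply: le_lt_trans (@sqnormD_le 1 (fun w => z * f w) g ltr01) _.
apply: lte_add_pinfty; apply: lte_mul_pinfty; rewrite ?lee_fin ?addr_ge0 ?invr_ge0 ?sqnorm_ge0//.
rewrite sqnormZ; apply: lte_mul_pinfty; rewrite ?lee_fin ?sqmod_ge0//.
Qed.

HB.instance Definition _ :=
  GRing.isSubmodClosed.Build R[i] (T -> R[i]) (@square_summable R T)
    square_summable_submod.
End ell2_sub.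

Record ell2 (R : realType) (T : choiceType) := Ell2 {
  ell2_fun :> T -> R[i];
  ell2_summable : square_summable ell2_fun }.

HB.instance Definition _ (R : realType) (T : choiceType) :=
  [isSub for @ell2_fun R T].
HB.instance Definition _ (R : realType) (T : choiceType) :=
  [Choice of ell2 R T by <:].
HB.instance Definition _ (R : realType) (T : choiceType) :=
  [SubChoice_isSubLmodule of ell2 R T by <:].

Section ell2_norm.
Context {R : realType} {T : choiceType}.
Implicit Types (f g : ell2 R T).

Definition ell2_norm f : R[i] := (Num.sqrt (fine (sqnorm f)))%:C.

Lemma sqnorm_fin f : sqnorm f \is a fin_num.
Proof. by rewrite ge0_fin_numE ?sqnorm_ge0//; exact: ell2_summable. Qed.

Lemma sqnormf_ge0 f : 0 <= fine (sqnorm f).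
Proof. by rewrite fine_ge0// sqnorm_ge0. Qed.

Lemma ell2_norm_ler_normD f g : ell2_norm (f + g) <= ell2_norm f + ell2_norm g.
Proof.
rewrite /ell2_norm -rmorphD/= lecR.
set a := Num.sqrt (fine (sqnorm f)); set b := Num.sqrt (fine (sqnorm g)).
have a0 : 0 <= a by exact: sqrtr_ge0.
have b0 : 0 <= b by exact: sqrtr_ge0.
have aE : fine (sqnorm f) = a ^+ 2 by rewrite sqr_sqrtr ?sqnormf_ge0.
have bE : fine (sqnorm g) = b ^+ 2 by rewrite sqr_sqrtr ?sqnormf_ge0.
have H (s : R) : 0 < s ->
    fine (sqnorm (f + g)) <= (1 + s) * a ^+ 2 + (1 + s^-1) * b ^+ 2.
  move=> s0; rewrite -aE -bE -lee_fin fineK ?sqnorm_fin// EFinD !EFinM.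
  by rewrite !fineK ?sqnorm_fin//; exact: sqnormD_le.
suff : fine (sqnorm (f + g)) <= (a + b) ^+ 2.
  move=> h; rewrite -[leRHS]ger0_norm ?addr_ge0// -sqrtr_sqr.
  exact: ler_wsqrtr.
apply/ler_addgt0Pr => e e0.
have [bp|] := ltP 0 b; last first.
  move=> bn; have b00 : b = 0 by apply/le_anti; rewrite bn b0.
  pose s := e / (1 + a ^+ 2).
  have d0 : 0 < 1 + a ^+ 2 by rewrite ltr_wpDr ?sqr_ge0.
  have s0 : 0 < s by rewrite divr_gt0.
  have := H s s0; rewrite b00 expr0n /= mulr0 !addr0 => /le_trans; apply.
  have : s * a ^+ 2 <= e.
    by rewrite /s mulrAC ler_pdivrMr// ler_wpM2l ?ltW// ltrDr.
  by lra.
have [ap|] := ltP 0 a; last first.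
  move=> an; have a00 : a = 0 by apply/le_anti; rewrite an a0.
  pose s := e / (1 + b ^+ 2).
  have d0 : 0 < 1 + b ^+ 2 by rewrite ltr_wpDr ?sqr_ge0.
  have s0 : 0 < s by rewrite divr_gt0.
  have sV0 : 0 < s^-1 by rewrite invr_gt0.
  have := H s^-1 sV0; rewrite invrK a00 expr0n /= mulr0 !add0r => /le_trans; apply.
  have : s * b ^+ 2 <= e.
    by rewrite /s mulrAC ler_pdivrMr// ler_wpM2l ?ltW// ltrDr.
  by lra.
have := H (b / a) (divr_gt0 bp ap) => /le_trans; apply.
suff -> : (1 + b / a) * a ^+ 2 + (1 + (b / a)^-1) * b ^+ 2 = (a + b) ^+ 2 by lra.
by field; rewrite !gt_eqF.
Qed.

Lemma ell2_normZ (z : R[i]) f : ell2_norm (z *: f) = `|z| * ell2_norm f.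
Proof.
rewrite /ell2_norm -[sqnorm _]/(sqnorm (fun w => z * f w)) sqnormZ.
rewrite fineM ?sqnorm_fin// sqrtrM ?sqmod_ge0// rmorphM/=.
by rewrite normc_def.
Qed.

Lemma sqmod_le_sqnorm (h : T -> R[i]) w : ((sqmod (h w))%:E <= sqnorm h)%E.
Proof.
rewrite /sqnorm (esumID [set w])//= ?setTI ?(setIidr (@subsetT _ _)) ?(setIidl (@subsetT _ _)).
  rewrite esum_set1 ?lee_fin ?sqmod_ge0// leeDl//.
  by apply: esum_ge0 => ? _; rewrite lee_fin sqmod_ge0.
by move=> ? _; rewrite lee_fin sqmod_ge0.
Qed.

Lemma sqmod_eq0 (z : R[i]) : sqmod z = 0 -> z = 0.
Proof.
move=> h; have := sqmod_normE z; rewrite h rmorph0 => /esym/eqP.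
by rewrite sqrf_eq0 normr_eq0 => /eqP.
Qed.

Lemma ell2_norm0_eq0 f : ell2_norm f = 0 -> f = 0.
Proof.
move=> /(congr1 (@Re R)) /= /eqP; rewrite sqrtr_eq0 => h.
apply/val_inj/funext => w /=; apply: sqmod_eq0.
apply/le_anti; rewrite sqmod_ge0 andbT -lee_fin.
apply: le_trans (sqmod_le_sqnorm f w) _.
by rewrite -(fineK (sqnorm_fin f)) lee_fin.
Qed.

HB.instance Definition _ := Lmodule_isNormed.Build R[i] (ell2 R T)
  ell2_norm_ler_normD ell2_normZ ell2_norm0_eq0.

Lemma ell2_normE f : `|f| = ell2_norm f. Proof. by []. Qed.
End ell2_norm.

Section ell2_complete.
Context {R : realType} {T : choiceType}.
Implicit Types (f g : ell2 R T).

Lemma ell2_norm_sqr f : (fine (sqnorm f))%:C = `|f| ^+ 2.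
Proof.
by rewrite ell2_normE /ell2_norm -rmorphXn/= sqr_sqrtr ?sqnormf_ge0.
Qed.

Lemma ell2_norm_lt f (e : R) : 0 < e ->
  (`|f| < e%:C) = (fine (sqnorm f) < e ^+ 2).
Proof.
move=> e0; have := @ltr_pXn2r _ 2 isT `|f| e%:C.
rewrite !nnegrE normr_ge0 lecR (ltW e0) => /(_ isT isT) <-.
by rewrite -ell2_norm_sqr -rmorphXn/= ltcR.
Qed.

Lemma sqmod_lt (h : ell2 R T) (e : R) w : 0 < e -> `|h| < e%:C ->
  sqmod (h w) < e ^+ 2.
Proof.
move=> e0; rewrite ell2_norm_lt//; apply: le_lt_trans.
by rewrite -lee_fin fineK ?sqnorm_fin// sqmod_le_sqnorm.
Qed.

Lemma sqr_lt_norm (x e : R) : 0 < e -> x ^+ 2 < e ^+ 2 -> `|x| < e.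
Proof.
move=> e0; have := @ltr_pXn2r _ 2 isT `|x| e.
by rewrite !nnegrE normr_ge0 (ltW e0) real_normK ?num_real// => /(_ isT isT) ->.
Qed.

Lemma ell2_coord_cauchy (F : set_system (ell2 R T)) (c : R[i] -> R) w :
  ProperFilter F -> cauchy F ->
  (forall x y, c (x - y) = c x - c y) -> (forall z, c z ^+ 2 <= sqmod z) ->
  cvg ((fun f : ell2 R T => c (f w)) @ F).
Proof.
move=> FF Fc cB cle; apply: cauchy_cvg; apply: cauchy_exP => e e0.
have /cauchyP Fc' := Fc.
have [x Fx] : exists x, F (ball x e%:C) by apply: Fc'; rewrite ltcR.
exists (c (x w)); rewrite /nbhs/=; apply: filterS Fx => f.
rewrite -!ball_normE /= => h; rewrite -cB; apply: sqr_lt_norm => //.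
apply: le_lt_trans (cle _) _.
by have := @sqmod_lt (x - f) e w e0 h.
Qed.

Lemma ell2_complete (F : set_system (ell2 R T)) :
  ProperFilter F -> cauchy F -> cvg F.
Proof.
move=> FF Fc.
have cr w : cvg ((fun f : ell2 R T => Re (f w)) @ F).
  apply: ell2_coord_cauchy => // [[? ?] []//|[a b]].
  by rewrite /sqmod /= lerDl sqr_ge0.
have ci w : cvg ((fun f : ell2 R T => Im (f w)) @ F).
  apply: ell2_coord_cauchy => // [[? ?] []//|[a b]].
  by rewrite /sqmod /= lerDr sqr_ge0.
pose g w : R[i] := lim ((fun f : ell2 R T => Re (f w)) @ F) +i*
                   lim ((fun f : ell2 R T => Im (f w)) @ F).
have key (e : R) : 0 < e ->
    exists2 A, F A & forall f, A f -> (sqnorm (fun w => f w - g w)%R <= (e ^+ 2)%:E)%E.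
  move=> e0; have /cauchyP Fc' := Fc.
  have [x Fx] : exists x, F (ball x (e / 2)%:C).
    by apply: Fc'; rewrite ltcR divr_gt0.
  exists (ball x (e / 2)%:C) => // f xf.
  have near_f h : ball x (e / 2)%:C h -> fine (sqnorm (f - h)) < e ^+ 2.
    move=> xh; rewrite -ell2_norm_lt//.
    rewrite (splitr e) rmorphD/= -(subrK x f) -addrA.
    apply: le_lt_trans (ler_normD _ _) _; apply: ltrD.
      by rewrite distrC; move: xf; rewrite -ball_normE.
    by move: xh; rewrite -ball_normE.
  apply: ge_ereal_sup => _ [X [fX _] <-].
  rewrite fsbig_finite// sumEFin lee_fin.
  pose S (h : ell2 R T) : R := \sum_(w <- fset_set X) sqmod (f w - h w).
  have Sle : \forall h \near F, S h <= e ^+ 2.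
    apply: filterS Fx => h /near_f /ltW; apply: le_trans.
    rewrite -lee_fin fineK ?sqnorm_fin// /S.
    apply: ereal_sup_ubound; exists X => //.
    by rewrite fsbig_finite// sumEFin.
  apply: (closed_cvg (fun r : R => r <= e ^+ 2) (@closed_le _ _) Sle).
  apply: cvg_big => [|w _]; first exact: add_continuous.
  rewrite /sqmod; apply: cvgD.
    have -> : Re (f w - g w) = Re (f w) - lim ((fun f : ell2 R T => Re (f w)) @ F).
      by case: (f w).
    have H : Re (f w) - Re ((h : ell2 R T) w) @[h --> F] --> Re (f w) - lim ((fun f : ell2 R T => Re (f w)) @ F).
      by apply: cvgB; [exact: cvg_cst|exact: cr].
    have E : (fun h : ell2 R T => Re (f w - h w) ^+ 2) =
             (fun h : ell2 R T => (Re (f w) - Re (h w)) * (Re (f w) - Re (h w))).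
      by apply/funext => h; rewrite expr2; case: (f w) (h w) => ? ? [].
    rewrite E expr2; exact: (cvgM H H).
  have -> : Im (f w - g w) = Im (f w) - lim ((fun f : ell2 R T => Im (f w)) @ F).
    by case: (f w).
  have H : Im (f w) - Im ((h : ell2 R T) w) @[h --> F] --> Im (f w) - lim ((fun f : ell2 R T => Im (f w)) @ F).
      by apply: cvgB; [exact: cvg_cst|exact: ci].
    have E : (fun h : ell2 R T => Im (f w - h w) ^+ 2) =
             (fun h : ell2 R T => (Im (f w) - Im (h w)) * (Im (f w) - Im (h w))).
      by apply/funext => h; rewrite expr2; case: (f w) (h w) => ? ? [].
    rewrite E expr2; exact: (cvgM H H).
have gs : square_summable g.
  have [A FA HA] := key 1 ltr01.
  have [f Af] := filter_ex FA.
  rewrite /square_summable (_ : g = (fun w => f w + (-1) * (f w - g w))); last first.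
    by apply/funext => w; ring.
  apply: le_lt_trans (@sqnormD_le _ _ 1 _ (fun w => (-1) * (f w - g w)) ltr01) _.
  rewrite sqnormZ.
  apply: lte_add_pinfty; apply: lte_mul_pinfty; rewrite ?lee_fin ?addr_ge0 ?invr_ge0 ?sqnorm_ge0//.
    exact: ell2_summable.
  apply: lte_mul_pinfty; rewrite ?lee_fin ?sqmod_ge0//.
  by apply: le_lt_trans (HA _ Af) (ltry _).
apply/cvg_ex; exists (Ell2 gs).
apply/cvgrPdist_lt => -[e e'] ep.
have e'0 : e' = 0 by move: ep; rewrite ltcE /= => /andP[/eqP].
move: ep; rewrite e'0 -[_ +i* 0]/(e%:C) ltcR => ep.
have e20 : 0 < e / 2 by rewrite divr_gt0.
have [A FA HA] := key (e / 2) e20.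
apply: filterS FA => f /HA h; rewrite distrC ell2_norm_lt//.
have h' : fine (sqnorm (f - Ell2 gs)) <= (e / 2) ^+ 2.
  by rewrite -lee_fin fineK ?sqnorm_fin.
apply: le_lt_trans h' _.
have := mulr_gt0 ep ep; rewrite !expr2 => ?; nra.
Qed.

HB.instance Definition _ := Uniform_isComplete.Build (ell2 R T) ell2_complete.

Definition ell2_inner f g : R[i] := csum (fun w => f w * (g w)^*).

Lemma ell2_innerl (z : R[i]) g h f :
  ell2_inner (z *: g + h) f = z * ell2_inner g f + ell2_inner h f.
Proof.
have sp f1 f2 := summable_prod (ell2_summable f1) (ell2_summable f2).
have E : (fun w => (z *: g) w * (f w)^*) = (fun w => z * (g w * (f w)^*)).
  by apply/funext => w; rewrite -[(z *: g) w]/(z * g w) mulrA.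
have zgf := sp (z *: g) f; rewrite E in zgf.
rewrite /ell2_inner -(csumZ _ (sp g f)) -(csumD zgf (sp h f)).
by congr csum; apply/funext => w; rewrite -[(z *: g + h) w]/(z * g w + h w) mulrDl mulrA.
Qed.

Lemma ell2_innerC f g : ell2_inner f g = (ell2_inner g f)^*.
Proof.
rewrite /ell2_inner -csum_conj.
  by congr csum; apply/funext => w; rewrite rmorphM/= conjcK mulrC.
exact: summable_prod (ell2_summable _) (ell2_summable _).
Qed.

Lemma ell2_inner_bilinear :
  bilinear_for *%R (@Num.conj R[i] \; *%R) ell2_inner.
Proof.
split=> [f|f] z g h; first exact: ell2_innerl.
by rewrite (ell2_innerC f (z *: g + h)) ell2_innerl rmorphD rmorphM/= (ell2_innerC f g) (ell2_innerC f h).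
Qed.

HB.instance Definition _ := bilinear_isBilinear.Build R[i] (ell2 R T) (ell2 R T)
  R[i] *%R (@Num.conj R[i] \; *%R) ell2_inner ell2_inner_bilinear.

Lemma ell2_inner_hermitian f g :
  ell2_inner f g = (-1) ^+ false * Num.conj (ell2_inner g f).
Proof.
by rewrite expr0 mul1r; exact: ell2_innerC.
Qed.

HB.instance Definition _ := isHermitianSesquilinear.Build R[i] (ell2 R T)
  false (@Num.conj R[i]) ell2_inner ell2_inner_hermitian.

Lemma ell2_innerE f : ell2_inner f f = `|f| ^+ 2.
Proof.
rewrite -ell2_norm_sqr /ell2_inner /csum /rsum; congr (_ +i* _).
  rewrite [X in fine (_ - X)]esum1 ?sube0 => [|w _].
    congr fine; apply: eq_esum => w _; rewrite funeposE /= /sqmod.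
    rewrite (_ : Re _ = Re (f w) ^+ 2 + Im (f w) ^+ 2); last first.
      by case: (f w) => a b /=; ring.
    by apply/max_idPl; rewrite lee_fin addr_ge0 ?sqr_ge0.
  rewrite funenegE /= ; apply/max_idPr.
  rewrite lee_fin oppr_le0 (_ : Re _ = Re (f w) ^+ 2 + Im (f w) ^+ 2).
    by rewrite addr_ge0 ?sqr_ge0.
  by case: (f w) => a b /=; ring.
have Im0 w : Im (f w * (f w)^*) = 0 by case: (f w) => a b /=; ring.
by rewrite !esum1 ?sube0// => w _; rewrite ?funeposE ?funenegE /= Im0 ?oppr0 ?oppe0 maxxx.
Qed.

Lemma ell2_inner_gt0 f : f != 0 -> 0 < ell2_inner f f.
Proof. by move=> f0; rewrite ell2_innerE exprn_gt0// normr_gt0. Qed.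

HB.instance Definition _ := isDotProduct.Build R[i] (ell2 R T) ell2_inner
  ell2_inner_gt0.

HB.instance Definition _ := isHilbert.Build R (ell2 R T) ell2_innerE.
End ell2_complete.

Lemma ell2_basis_summable (R : realType) (T : choiceType) (w : T) :
  square_summable (fun x => (x == w)%:R : R[i]).
Proof.
rewrite /square_summable /sqnorm (esumID [set w]) /= => [|x _]; last first.
  by rewrite lee_fin sqmod_ge0.
rewrite setTI esum_set1 ?lee_fin ?sqmod_ge0// esum1 ?adde0 ?ltry// => x [_ /= /eqP].
by move=> /negPf ->; rewrite /sqmod /= expr0n addr0.
Qed.

Definition ell2_basis (R : realType) (T : choiceType) (w : T) : ell2 R T :=
  Ell2 (ell2_basis_summable R w).

Definition closed_subspace (R : realType) (H : normedModType R[i]) (L : set H) :=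
  [/\ closed L, L 0 & forall (c : R[i]) u v, L u -> L v -> L (c *: u + v)].

Definition closed_span (R : realType) (H : normedModType R[i]) (A : set H) : set H :=
  smallest (@closed_subspace R H) A.

(* Unital C*-algebras. The product is a field of the mixin because no structure
   of the library joins rings and normed modules. *)
HB.mixin Record isCStarAlgebra (R : realType) A & CompleteNormedModule R[i] A := {
  cmul : {bilinear A -> A -> A};
  cone : A;
  cmulA : associative cmul;
  cmul1r : left_id cone cmul;
  cmulr1 : right_id cone cmul;
  cmul_norm : forall x y : A, `|cmul x y| <= `|x| * `|y|;
  star : A -> A;
  starK : involutive star;
  starD : {morph star : x y / x + y};
  starZ : forall (c : R[i]) x, star (c *: x) = Num.conj c *: star x;
  starM : forall x y, star (cmul x y) = cmul (star y) (star x);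
  cstarE : forall x : A, `|cmul (star x) x| = `|x| ^+ 2 }.
#[short(type="cstarAlgType")]
HB.structure Definition CStarAlgebra (R : realType) :=
  {A of isCStarAlgebra R A & CompleteNormedModule R[i] A}.

Definition closed_star_subalgebra (R : realType) (A : cstarAlgType R)
    (B : set A) :=
  [/\ closed_subspace B, B cone, forall x y, B x -> B y -> B (cmul x y) &
      forall x, B x -> B (star x)].

(* Unital *-representations, i.e. unital *-homomorphisms into the bounded
   operators on a Hilbert space. *)
Record representation (R : realType) (A : cstarAlgType R) (H : hilbertType R) :=
  Representation {
    repr_op :> A -> {linear H -> H};
    repr_bounded : forall a, continuous (repr_op a);
    repr_linear : forall (c : R[i]) a b v,
      repr_op (c *: a + b) v = c *: repr_op a v + repr_op b v;
    repr_mul : forall a b v, repr_op (cmul a b) v = repr_op a (repr_op b v);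
    repr_one : forall v, repr_op cone v = v;
    repr_star : forall a u v,
      inner (repr_op a u) v = inner u (repr_op (star a) v) }.

(* Bounded operators T_i with adjoints T'_i satisfying T'_i T_j = delta_ij and
   sum_i T_i T'_i = 1. *)
Record cuntz_family (R : realType) (N : nat) (H : hilbertType R)
    (T T' : 'I_N -> {linear H -> H}) : Prop := CuntzFamily {
  cuntz_bounded : forall i, continuous (T i);
  cuntz_adjoint : forall i u v, inner (T i u) v = inner u (T' i v);
  cuntz_isometry : forall i j v, T' i (T j v) = if i == j then v else 0;
  cuntz_range : forall v, \sum_(i < N) T i (T' i v) = v }.

(* [A] is O_N with generators [S]. Universality is stated for operators on
   Hilbert spaces, which is the same as universality among unital C*-algebras
   since each of these embeds isometrically into some B(H). *)
Record cuntz_algebra (R : realType) (N : nat) (A : cstarAlgType R)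
    (S : 'I_N -> A) : Prop := CuntzAlgebra {
  cuntz_alg_isometry : forall i j,
    cmul (star (S i)) (S j) = if i == j then cone else 0;
  cuntz_alg_range : \sum_(i < N) cmul (S i) (star (S i)) = cone;
  cuntz_alg_generated :
    smallest (@closed_star_subalgebra R A) (range S) = [set: A];
  cuntz_alg_universal : forall (H : hilbertType R) (T T' : 'I_N -> {linear H -> H}),
    cuntz_family T T' ->
    exists pi : representation A H,
      (forall i v, pi (S i) v = T i v) /\
      (forall pi' : representation A H,
        (forall i v, pi' (S i) v = T i v) -> forall a v, pi' a v = pi a v) }.

Definition closed_invariant_subspace (R : realType) (A : cstarAlgType R)
    (H : hilbertType R) (pi : representation A H) (L : set H) :=
  closed_subspace L /\ forall a v, L v -> L (pi a v).

(* The restriction of [pi] to the closed invariant subspace [K] is irreducible. *)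
Definition irreducible_on (R : realType) (A : cstarAlgType R)
    (H : hilbertType R) (pi : representation A H) (K : set H) :=
  forall L : set H, closed_invariant_subspace pi L -> L `<=` K ->
    L = [set 0] \/ L = K.

Record irreducible_decomposition (R : realType) (A : cstarAlgType R)
    (H : hilbertType R) (pi : representation A H)
    (J : Type) (D : set J) (K : J -> set H) : Prop := IrreducibleDecomposition {
  decomp_invariant : forall j, D j -> closed_invariant_subspace pi (K j);
  decomp_irreducible : forall j, D j -> irreducible_on pi (K j);
  decomp_orthogonal : forall j k, D j -> D k -> j <> k ->
    forall u v, K j u -> K k v -> inner u v = 0;
  decomp_span : closed_span (\bigcup_(j in D) K j) = [set: H] }.

Record branching_function_system (N : nat) (W : Type) (f : 'I_N -> W -> W) :
    Prop := BranchingFunctionSystem {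
  bfs_inj : forall i, injective (f i);
  bfs_disjoint : trivIset setT (fun i => range (f i));
  bfs_cover : \bigcup_i range (f i) = setT }.

Definition permutative_representation (R : realType) (N : nat) (W : choiceType)
    (f : 'I_N -> W -> W) (A : cstarAlgType R) (S : 'I_N -> A)
    (pi : representation A (ell2 R W)) :=
  forall i w, pi (S i) (ell2_basis R w) = ell2_basis R (f i w).

Lemma isometric_continuous (K : numFieldType) (V V' : normedModType K)
  (h : V -> V') : (forall u v, `|h u - h v| = `|u - v|) -> continuous h.
Proof.
move=> hE u; apply/cvgrPdist_lt => e e0.
by apply/nbhs_normP; exists e => //= v uv; rewrite hE.
Qed.

(* Every branching function system does induce a permutative representation:
   the section below builds its operators S_i and S_i^*. *)
Section permutative.
Context {R : realType} {W : choiceType}.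
Variable (g : W -> W).
Hypothesis gI : injective g.

Let ginv w : option W :=
  if pselect (exists v, g v = w) is left h then Some (projT1 (cid h)) else None.

Lemma ginvK v : ginv (g v) = Some v.
Proof.
rewrite /ginv; case: pselect => [h|[]]; last by exists v.
by case: cid => /= x /gI ->.
Qed.

Lemma ginv_some w v : ginv w = Some v -> w = g v.
Proof. by rewrite /ginv; case: pselect => // h [<-]; case: cid. Qed.

Lemma ginvN w : ~ range g w -> ginv w = None.
Proof. by rewrite /ginv; case: pselect => // h []; case: h => v gv; exists v. Qed.

Lemma esum_push (a : W -> \bar R) : (forall w, 0 <= a w)%E ->
  (forall w, ~ range g w -> a w = 0)%E ->
  (\esum_(w in [set: W]) a w = \esum_(w in [set: W]) a (g w))%E.
Proof.
move=> a0 aN; rewrite (esumID (range g))//.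
have -> : (\esum_(w in [set: W] `&` ~` range g) a w = 0)%E.
  by apply: esum1 => w [_ /= /aN].
rewrite adde0 setTI esum_image// => x y _ _; exact: gI.
Qed.

Definition push_fun (f : W -> R[i]) : W -> R[i] :=
  fun w => oapp f 0 (ginv w).

Lemma push_funE f v : push_fun f (g v) = f v.
Proof. by rewrite /push_fun ginvK. Qed.

Lemma push_funN f w : ~ range g w -> push_fun f w = 0.
Proof. by move=> /ginvN; rewrite /push_fun => ->. Qed.

Lemma sqnorm_push f : sqnorm (push_fun f) = sqnorm f.
Proof.
rewrite /sqnorm esum_push => [|w|w /(push_funN f) ->].
- by apply: eq_esum => w _; rewrite push_funE.
- by rewrite lee_fin sqmod_ge0.
- by rewrite /sqmod /= expr0n addr0.
Qed.

Lemma sqnorm_pull (f : W -> R[i]) : (sqnorm (f \o g) <= sqnorm f)%E.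
Proof.
rewrite -sqnorm_push; apply: le_esum => w _; rewrite lee_fin.
have [[v _ <-]|/(push_funN (f \o g)) ->] := pselect (range g w).
  by rewrite push_funE.
by rewrite {1}/sqmod /= expr0n addr0 sqmod_ge0.
Qed.

Lemma push_summable (f : ell2 R W) : square_summable (push_fun f).
Proof. by rewrite /square_summable sqnorm_push; exact: ell2_summable. Qed.

Lemma pull_summable (f : ell2 R W) : square_summable (f \o g).
Proof. by apply: le_lt_trans (sqnorm_pull f) _; exact: ell2_summable. Qed.

Definition push f : ell2 R W := Ell2 (push_summable f).
Definition pull f : ell2 R W := Ell2 (pull_summable f).

Lemma push_linear : linear push.
Proof.
move=> c f h; apply/val_inj/funext => w /=.
rewrite -[RHS]/(c * push_fun f w + push_fun h w) /push_fun.
by case: ginv => //=; rewrite mulr0 addr0.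
Qed.

Lemma pull_linear : linear pull.
Proof. by move=> c f h; apply/val_inj/funext. Qed.

HB.instance Definition _ := GRing.isLinear.Build R[i] (ell2 R W) (ell2 R W) *:%R
  push push_linear.
HB.instance Definition _ := GRing.isLinear.Build R[i] (ell2 R W) (ell2 R W) *:%R
  pull pull_linear.

Lemma push_norm f : `|push f| = `|f|.
Proof. by rewrite !ell2_normE /ell2_norm /= sqnorm_push. Qed.

Lemma push_continuous : continuous push.
Proof.
by apply: isometric_continuous => u v; rewrite -linearB push_norm.
Qed.

Lemma rsum_push (a : W -> R) : (forall w, ~ range g w -> a w = 0) ->
  rsum a = rsum (a \o g).
Proof.
move=> aN; rewrite /rsum; congr (fine (_ - _)).
  rewrite (@esum_push (EFin \o a)^\+%E)//.
    by apply: eq_esum => w _; rewrite !funeposE.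
  by move=> w /aN h; rewrite funeposE /= h maxxx.
rewrite (@esum_push (EFin \o a)^\-%E)//.
  by apply: eq_esum => w _; rewrite !funenegE.
by move=> w /aN h; rewrite funenegE /= h oppr0 maxxx.
Qed.

Lemma csum_push (a : W -> R[i]) : (forall w, ~ range g w -> a w = 0) ->
  csum a = csum (a \o g).
Proof.
move=> aN; rewrite /csum; congr (_ +i* _).
  by rewrite (rsum_push (a := fun w => Re (a w))) // => w /aN ->.
by rewrite (rsum_push (a := fun w => Im (a w))) // => w /aN ->.
Qed.

Lemma push_adjoint u v : inner (push u) v = inner u (pull v).
Proof.
rewrite -[LHS]/(csum (fun w => push_fun u w * (v w)^*)).
rewrite -[RHS]/(csum (fun w => u w * (v (g w))^*)).
rewrite csum_push => [|w /(push_funN u) ->]; last by rewrite mul0r.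
by congr csum; apply/funext => w /=; rewrite push_funE.
Qed.

Lemma push_basis w : push (ell2_basis R w) = ell2_basis R (g w).
Proof.
apply/val_inj/funext => x /=.
have [[v _ <-]|nx] := pselect (range g x).
  by rewrite push_funE (inj_eq gI).
rewrite push_funN//; case: eqP => // xw; case: nx; exists w => //.
Qed.
End permutative.

Lemma ell2_sumE (R : realType) (W : choiceType) (N : nat)
    (F : 'I_N -> ell2 R W) w : (\sum_(i < N) F i) w = \sum_(i < N) F i w.
Proof.
by apply: (big_ind2 (fun (u : ell2 R W) (c : R[i]) => u w = c)) => // u c v d <- <-.
Qed.

Lemma permutative_exists (R : realType) (N : nat) (W : choiceType)
    (f : 'I_N -> W -> W) (A : cstarAlgType R) (S : 'I_N -> A) :
  branching_function_system f -> cuntz_algebra S ->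
  exists pi : representation A (ell2 R W), permutative_representation f S pi.
Proof.
move=> [fI fD fC] [_ _ _ univ].
pose T i : {linear ell2 R W -> ell2 R W} := push (fI i).
pose T' i : {linear ell2 R W -> ell2 R W} := pull (fI i).
have disj i j w : range (f i) w -> range (f j) w -> i = j.
  by move=> iw jw; apply: (fD i j) => //; exists w.
have fam : cuntz_family T T'.
  split.
  - by move=> i; exact: push_continuous.
  - by move=> i u v; exact: push_adjoint.
  - move=> i j v; apply/val_inj/funext => w /=.
    case: eqP => [->|ij]; first by rewrite push_funE.
    rewrite push_funN// => jw; case: ij; apply: (disj _ _ _ _ jw).
    by exists w.
  - move=> v; apply/val_inj/funext => w.
    have [i _ [x _ fx]] : (\bigcup_i range (f i)) w by rewrite fC.
    rewrite [LHS](ell2_sumE (fun i => T i (T' i v)) w) (bigD1 i)//= big1 ?addr0.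
      by rewrite -fx push_funE.
    move=> j ji; rewrite push_funN// => jw; move/eqP: ji; apply.
    by apply: (disj _ _ _ jw); exists x.
have [pi [piE _]] := univ _ _ _ fam; exists pi => i w.
by rewrite piE; exact: push_basis.
Qed.

Definition irr01 (R : realType) : set R := `[0, 1]%classic `&` @irrational R.
Arguments irr01 R : clear implicits.

(* [h] agrees on [0, 1] with the fractional linear transformation of an element
   of PGL_2(Z), which has no pole there. *)
Definition PGL2Z_on01 (R : realType) (h : R -> R) :=
  exists2 M : 'M[int]_2, `|\det M| = 1 &
    forall x : R, x \in `[0, 1] ->
      (M 1 0)%:~R * x + (M 1 1)%:~R != 0 /\
      h x = ((M 0 0)%:~R * x + (M 0 1)%:~R) / ((M 1 0)%:~R * x + (M 1 1)%:~R).

Definition unimodular_interval (R : realType) (J : set R) :=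
  exists p q p' q' : int,
    [/\ 0 < q /\ 0 < q', coprimez p q /\ coprimez p' q', p * q' - p' * q = -1,
        J = `[p%:~R / q%:~R, p'%:~R / q'%:~R]%classic & J `<=` `[0, 1]%classic].

Definition unimodular_partition (R : realType) (N : nat) (J : 'I_N -> set R) :=
  [/\ forall i, unimodular_interval (J i), \bigcup_i J i = `[0, 1]%classic &
      forall i j, i != j -> is_subset1 (J i `&` J j)].

(* Slow continued fraction algorithms; only the values of h_i on [0, 1] matter. *)
Record slow_cfa (R : realType) (N : nat) (h : 'I_N -> R -> R) : Prop := SlowCfa {
  scfa_ge2 : (2 <= N)%N;
  scfa_PGL2Z : forall i, PGL2Z_on01 (h i);
  scfa_partition : unimodular_partition (fun i => h i @` `[0, 1]%classic);
  scfa_ordered : forall i j : 'I_N, (i < j)%N ->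
    forall x y : R, (h i @` `[0, 1]%classic) x -> (h j @` `[0, 1]%classic) y -> x <= y }.

Lemma det_mx2 (M : 'M[int]_2) : \det M = M 0 0 * M 1 1 - M 0 1 * M 1 0.
Proof.
rewrite (expand_det_row _ 0) !big_ord_recl big_ord0 addr0 /cofactor !det_mx11 !mxE /=.
have e0 : lift ord0 0 = 1 :> 'I_2 by exact/val_inj.
have e1 : lift 1 0 = 0 :> 'I_2 by exact/val_inj.
rewrite -[lift ord0 ord0]/(lift ord0 0 : 'I_2) !e0 e1.
by rewrite expr0 expr1 mul1r mulN1r mulrN.
Qed.

Section scfa_bfs.
Context {R : realType} {N : nat} {h : 'I_N -> R -> R}.
Hypothesis hh : slow_cfa h.

Lemma rational_int (a : int) : @rational R a%:~R.
Proof. by exists a%:~R => //; rewrite ratr_int. Qed.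

Lemma rational_div (x y : R) : rational x -> rational y -> rational (x / y).
Proof. by move=> [a _ <-] [b _ <-]; exists (a / b) => //; rewrite fmorph_div. Qed.

Lemma rational_lin (a b : int) (y : R) :
  rational y -> rational (a%:~R * y + b%:~R).
Proof.
by move=> [c _ <-]; exists (a%:~R * c + b%:~R) => //; rewrite rmorphD rmorphM/= !ratr_int.
Qed.

Lemma scfa_inv i : exists a b c d : int, forall x y : R, x \in `[0, 1] -> y = h i x ->
  (- c%:~R * y + a%:~R != 0 :> R) /\ x = (d%:~R * y + (- b)%:~R) / ((- c)%:~R * y + a%:~R).
Proof.
have [M dM Mx] := scfa_PGL2Z hh i.
exists (M 0 0), (M 0 1), (M 1 0), (M 1 1) => x y x01 ->.
have [dn ->] := Mx x x01.
move: dM; rewrite det_mx2 => dM.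
move: (M 0 0) (M 0 1) (M 1 0) (M 1 1) dn dM => a b c d dn dM.
have D : (a * d - b * c)%:~R != 0 :> R.
  by rewrite intr_eq0 -normr_eq0 dM oner_eq0.
move: D; rewrite rmorphB !rmorphM/= => D.
have E : - c%:~R * ((a%:~R * x + b%:~R) / (c%:~R * x + d%:~R)) + a%:~R =
   (a%:~R * d%:~R - b%:~R * c%:~R) / (c%:~R * x + d%:~R) :> R by field.
split; first by rewrite E mulf_neq0 ?invr_eq0.
rewrite !rmorphN/= E; field; by rewrite dn D.
Qed.

Lemma scfa_irr i x : x \in irr01 R -> h i x \in irr01 R.
Proof.
rewrite !inE => -[x01 xirr]; split.
  have [_ <- _] := scfa_partition hh.
  by exists i => //; exists x.
move=> hrat; apply: xirr.
have [a [b [c [d H]]]] := scfa_inv i.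
have [_ ->] := H x _ x01 erefl.
by apply: rational_div; apply: rational_lin.
Qed.

(* The restrictions f_i of the h_i to the irrationals of [0, 1]. *)
Definition scfa_bfs (i : 'I_N) (x : irr01 R) : irr01 R :=
  exist _ (h i (val x)) (scfa_irr i (valP x)).

Lemma scfa_bfsP : branching_function_system scfa_bfs.
Proof.
have [Ju Jc J1] := scfa_partition hh.
split.
- move=> i x y /(congr1 val)/= e; apply/val_inj => /=.
  have [a [b [c [d H]]]] := scfa_inv i.
  have [x01 _] := set_mem (valP x); have [y01 _] := set_mem (valP y).
  have [_ ->] := H _ _ x01 erefl; have [_ ->] := H _ _ y01 erefl.
  by rewrite e.
- move=> i j _ _ [_ [[x _ <-] [y _ /(congr1 val)/= e]]].
  apply/eqP; apply: contraT => /J1 one.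
  have [x01 _] := set_mem (valP x); have [y01 _] := set_mem (valP y).
  have [_ zirr] := set_mem (valP (scfa_bfs i x)).
  set z := h i (val x) in e zirr *.
  have zi : (h i @` `[0, 1]%classic) z by exists (val x).
  have zj : (h j @` `[0, 1]%classic) z by exists (val y).
  have [p [q [p' [q' [_ _ _ Ji _]]]]] := Ju i.
  have [r [s [r' [s' [_ _ _ Jj _]]]]] := Ju j.
  have rat (u v : int) : @rational R (u%:~R / v%:~R).
    by apply: rational_div; exact: rational_int.
  pose m := Num.max (p%:~R / q%:~R) (r%:~R / s%:~R) : R.
  have mrat : rational m by rewrite /m maxEle; case: ifP.
  exfalso; apply: zirr; rewrite -/z (_ : val _ = m)//; apply: one; split => //.
  + move: zi zj; rewrite Ji Jj /= !in_itv /= => /andP[pz zp] /andP[rz zr].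
    by rewrite le_max lexx/= (le_trans _ zp)// ge_max pz rz.
  + move: zi zj; rewrite Ji Jj /= !in_itv /= => /andP[pz zp] /andP[rz zr].
    by rewrite le_max lexx orbT/= (le_trans _ zr)// ge_max pz rz.
- apply/seteqP; split => // z _.
  have [z01 zirr] := set_mem (valP z).
  move: (z01); rewrite -Jc => -[i _ [x x01 hx]].
  have xirr : x \in irr01 R.
    rewrite inE; split => // xrat; apply: zirr; rewrite -hx.
    have [M _ Mx] := scfa_PGL2Z hh i; have [_ ->] := Mx x x01.
    by apply: rational_div; apply: rational_lin.
  by exists i => //; exists (exist _ x xirr) => //; apply/val_inj.
Qed.
End scfa_bfs.

Section itineraries.
Context {R : realType} {N : nat}.
Variable h : 'I_N -> R -> R.

(* h_{s_0} o ... o h_{s_{n-1}}; the entry x_k of an itinerary is [s k.-1]. *)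
Fixpoint word_map (s : nat -> 'I_N) (n : nat) : R -> R :=
  if n is m.+1 then word_map s m \o h (s m) else id.

Definition itinerary (s : nat -> 'I_N) (x : R) :=
  (\bigcap_(n in [set n | (1 <= n)%N]) (word_map s n @` `[0, 1]%classic)) x.

Definition tail_equivalent (s t : nat -> 'I_N) :=
  exists (z : int) (m : nat), forall n, (m <= n)%N ->
    exists2 k : nat, k%:Z = n%:Z + z & s k = t n.

Definition orbit_rel (x y : R) :=
  exists s t, [/\ itinerary s x, itinerary t y & tail_equivalent s t].

Definition orbit_class (x : irr01 R) : set (irr01 R) :=
  [set y | orbit_rel (val y) (val x)].

Definition orbit_space : set (set (irr01 R)) := range orbit_class.
End itineraries.

(* The closed subspace with orthonormal basis (e_y), y in C. *)
Definition ell2_sub (R : realType) (W : choiceType) (C : set W) :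
  set (ell2 R W) := closed_span [set ell2_basis R y | y in C].

(* Main.v *)
Require Import Defs.
From HB Require Import structures.
From mathcomp Require Import all_boot all_order all_algebra.
From mathcomp Require Import boolp classical_sets functions reals.
From mathcomp Require Import ereal topology normedtype esum complex.
From mathcomp Require Import cardinality numfun finmap ring lra zify.
Set Implicit Arguments.
Unset Strict Implicit.
Unset Printing Implicit Defensive.
Import Order.TTheory GRing.Theory Num.Theory numFieldNormedType.Exports.
Local Open Scope classical_set_scope.
Local Open Scope ring_scope.

(** The argument separates a general fact on branching function systems from an
    arithmetic fact on slow continued fraction algorithms.

    General fact ([orbit_decomposition]). Let [f] be a branching function system
    whose points are determined by their itineraries, and call two points
    equivalent when both are images of one point under words in the [f i]. The
    subspaces [ell2_sub C], [C] an equivalence class, are the irreducible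
    summands.
    - Invariance ([ell2_sub_invariant]). Let U be the diagonal operator with
      entries 1 on [C] and -1 off [C]. As [C] and its complement are stable under
      the [f i] and their inverses, U commutes with every [pi (S i)], so
      U pi(.) U is a representation that agrees with [pi] on the generators. By
      the uniqueness part of the universal property of O_N it is [pi], so U
      commutes with the whole image of [pi], whose elements therefore preserve
      the eigenspace [ell2_sub C] of U. No continuity of [pi] is needed.
    - Irreducibility. Let [L] be a closed invariant subspace with a vector [v] such
      that [v y != 0], and let [r] be the itinerary of [y]. The projections
      S_s S_s^*, [s] the prefixes of [r], restrict [v] to smaller and smaller
      cylinders whose only common point is [y], so by dominated convergence
      [v y *: e y] lies in [L] ([coord_basis_in]). From [e y] the operators S_i
      and S_i^* reach every [e z] with [z] equivalent to [y].

    Arithmetic fact ([itinerary_inj]). A composite of [n] maps [h i] is a fractional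
    linear map that sends 0 and 1 to reduced fractions with denominators [u] and
    [v], and the image of [0, 1] has length 1 / (u v). As no [h i] maps onto
    [0, 1], each composition increases [u + v] by at least one
    ([fraction_den_growth]), so the nested images shrink to a point.

    On irrational points [orbit_rel] is the equivalence of the general fact
    ([orbit_relP]), because after their tails have been matched two irrational
    points have the same itinerary. *)

(** * Square-summable families *)

Section ell2_coordinates.
Context {R : realType} {T : choiceType}.
Implicit Types (u v : ell2 R T) (C : set T).
Local Notation e w := (ell2_basis R (w : T)).

Lemma ell2P u v : (forall w, u w = v w) -> u = v.
Proof. by move=> h; apply/val_inj/funext. Qed.

Lemma ell2_basisE w x : e w x = (x == w)%:R.
Proof. by []. Qed.

Lemma esum_single (a : T -> \bar R) w : (forall x, 0 <= a x)%E ->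
  (forall x, x != w -> a x = 0)%E -> (\esum_(x in [set: T]) a x = a w)%E.
Proof.
move=> a0 aw; rewrite (esumID [set w])// setTI esum_set1//.
by rewrite esum1 ?adde0// => x [_ /= /eqP /aw].
Qed.

Lemma rsum_single (a : T -> R) w : (forall x, x != w -> a x = 0) ->
  rsum a = a w.
Proof.
move=> aw; rewrite /rsum (@esum_single _ w)//; last first.
  by move=> x /aw h; rewrite funeposE /= h maxxx.
rewrite (@esum_single _ w)//; last first.
  by move=> x /aw h; rewrite funenegE /= h oppr0 maxxx.
by rewrite -[X in _ = X]/(fine ((EFin \o a) w)) [in RHS](funeposneg (EFin \o a)).
Qed.

Lemma csum_single (a : T -> R[i]) w : (forall x, x != w -> a x = 0) ->
  csum a = a w.
Proof.
move=> aw; apply: cext => /=.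
  by apply: (@rsum_single (fun x => complex.Re (a x))) => x /aw ->.
by apply: (@rsum_single (fun x => complex.Im (a x))) => x /aw ->.
Qed.

Lemma inner_basis u w : inner (e w) u = (u w)^*%C.
Proof.
rewrite -[LHS]/(csum (fun x => e w x * (u x)^*%C)) (@csum_single _ w).
  by rewrite ell2_basisE eqxx mul1r.
by move=> x /negPf xw; rewrite ell2_basisE xw mul0r.
Qed.

(** Square-summable families with disjoint supports are orthogonal. *)
Lemma inner_disjoint u v : (forall w, u w = 0 \/ v w = 0) -> inner u v = 0.
Proof.
move=> uv; rewrite -[LHS]/(csum (fun w => u w * (v w)^*%C)).
have E w : u w * (v w)^*%C = 0.
  by case: (uv w) => ->; rewrite ?mul0r// conjc0 mulr0.
under [X in csum X]funext do rewrite E.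
rewrite /csum /rsum !esum1 ?sube0 // => w _;
  by rewrite ?funeposE ?funenegE /= ?oppr0 maxxx.
Qed.

(** The norm of a square-summable family is small outside a finite set. *)
Lemma ell2_tail v (d : R) : 0 < d -> exists X : set T, finite_set X /\
  (\esum_(w in ~` X) (sqmod (v w))%:E < d%:E)%E.
Proof.
move=> d0; have fv := sqnorm_fin v.
have [_ [X [fX _] <-]] := ub_ereal_sup_adherent d0 fv.
rewrite -[ereal_sup _]/(sqnorm v) => h; exists X; split => //.
have a0 w : (0 <= (sqmod (v w))%:E :> \bar R)%E by rewrite lee_fin sqmod_ge0.
have E : sqnorm v = (\esum_(w in X) (sqmod (v w))%:E +
    \esum_(w in ~` X) (sqmod (v w))%:E)%E.
  by rewrite /sqnorm (esumID X)// ?setTI.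
rewrite -esum_fset// in h.
move: h fv; rewrite E.
have b0 : (0 <= \esum_(w in X) (sqmod (v w))%:E)%E by apply: esum_ge0.
have c0 : (0 <= \esum_(w in ~` X) (sqmod (v w))%:E)%E by apply: esum_ge0.
case: (esum X _) b0 => [b| |] //=; case: (esum (~` X) _) c0 => [c| |] //=.
by rewrite -!EFinD !lte_fin => _ _; lra.
Qed.

(** A form of dominated convergence: [u] lies in the closed set [L] as soon as
    [L] contains elements that agree with [u] on arbitrarily large finite sets
    of coordinates and differ from [u] in every coordinate by at most a fixed
    square-summable family [v]. *)
Lemma closed_dominated (L : set (ell2 R T)) u v : closed L ->
  (forall X : set T, finite_set X -> exists2 g, L g &
     (forall w, X w -> g w = u w) /\
     (forall w, sqmod (u w - g w) <= sqmod (v w))) -> L u.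
Proof.
move=> cL H; apply: cL => B /nbhs_normP [[d d'] /= dp uB].
have d'0 : d' = 0 by move: dp; rewrite ltcE /= => /andP[/eqP].
move: dp uB; rewrite d'0 -[complex.Complex d 0]/(d%:C)%C ltcR => dp uB.
have [X [fX hX]] := @ell2_tail v (d ^+ 2) (exprn_gt0 _ dp).
have [g Lg [gX gv]] := H X fX; exists g; split => //; apply: uB => /=.
rewrite ell2_norm_lt// -lte_fin fineK ?sqnorm_fin//; apply: le_lt_trans hX.
rewrite /sqnorm (esumID X)/=; last by move=> w _; rewrite lee_fin sqmod_ge0.
rewrite !setTI esum1 ?add0e.
  by apply: le_esum => w _; rewrite lee_fin; exact: gv.
move=> w /gX h; rewrite -[LHS]/((sqmod (u w - g w))%:E) h subrr.
by rewrite /sqmod /= expr0n addr0.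
Qed.

Lemma closed_subspace_stable (L : set (ell2 R T)) : closed_subspace L ->
  (forall u v, L u -> L v -> L (u + v)) /\ (forall c u, L u -> L (c *: u)).
Proof.
move=> [_ L0 LL]; split => [u v Lu Lv|c u Lu].
  by have := LL 1 u v Lu Lv; rewrite scale1r.
by have := LL c u 0 Lu L0; rewrite addr0.
Qed.

(** A closed subspace containing the basis vectors indexed by [C] contains every
    family supported in [C]. *)
Lemma closed_subspace_full (L : set (ell2 R T)) C : closed_subspace L ->
  (forall w, C w -> L (e w)) -> forall v, (forall w, ~ C w -> v w = 0) -> L v.
Proof.
move=> hL Le v vC; have [cL L0 _] := hL; have [LD LZ] := closed_subspace_stable hL.
apply: (@closed_dominated L v v) => // X fX.
have xfun (r : seq T) : uniq r ->
    (exists2 g, L g & forall w, g w = if w \in r then v w else 0).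
  elim: r => [_|x r IH /= /andP[xr /IH[g Lg gE]]]; first by exists 0.
  exists (v x *: e x + g).
    apply: LD => //; have [Cx|/vC ->] := pselect (C x); last by rewrite scale0r.
    by apply: LZ; apply: Le.
  move=> w; rewrite -[LHS]/(v x * (w == x)%:R + g w) gE inE.
  have [->|_] /= := eqVneq w x; last by rewrite mulr0 add0r.
  by rewrite (negPf xr) mulr1 addr0.
have [g Lg gE] := xfun _ (fset_uniq (fset_set X)); exists g => //.
split=> [w Xw|w]; rewrite gE; first by rewrite in_fset_set// mem_set.
case: ifP; rewrite ?subr0// subrr => _.
by rewrite {1}/sqmod /= expr0n addr0 sqmod_ge0.
Qed.

Lemma closed_subspace_supp C :
  closed_subspace [set v : ell2 R T | forall w, ~ C w -> v w = 0].
Proof.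
split=> [v vcl w Cw|//|c u v hu hv w Cw]; last first.
  by rewrite -[LHS]/(c * u w + v w) hu// hv// mulr0 addr0.
apply: sqmod_eq0; apply/eqP; rewrite eq_le sqmod_ge0 andbT.
apply/ler_addgt0Pr => d d0; rewrite add0r.
have [g [gC]] : [set v : ell2 R T | forall w, ~ C w -> v w = 0] `&`
    ball v (Num.sqrt d)%:C%C !=set0.
  by apply: vcl; apply: nbhsx_ballx; rewrite ltcR sqrtr_gt0.
rewrite -ball_normE /= => h.
have := @sqmod_lt _ _ (v - g) _ w _ h; rewrite sqrtr_gt0 => /(_ d0).
rewrite -[(v - g) w]/(v w - g w) gC// subr0 sqr_sqrtr; last exact: ltW.
exact: ltW.
Qed.

(** The closed span of the [e w], [w] in [C], consists of the families
    supported in [C]. *)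
Lemma ell2_subP C v : ell2_sub C v <-> forall w, ~ C w -> v w = 0.
Proof.
split; last first.
  move=> vC L [hL Le]; apply: (closed_subspace_full hL _ vC) => w Cw.
  by apply: Le; exists w.
move/(_ [set u | forall w, ~ C w -> u w = 0]); apply; split; first exact: closed_subspace_supp.
move=> _ [x Cx <-] w /= Cw.
by case: eqP => // wx; rewrite wx in Cw.
Qed.

End ell2_coordinates.

(** * Words and orbits of a branching function system *)

Section bfs_words.
Context {N : nat} {W : Type} (f : 'I_N -> W -> W).
Hypothesis fbfs : branching_function_system f.
Implicit Types (s t : seq 'I_N) (r : nat -> 'I_N) (w x y z : W).

(** The composite f_{s_0} o ... o f_{s_k} of the letters of [s]; the last letter
    is applied first. *)
Definition word s : W -> W := fun w => foldr f w s.

Lemma word_cat s t w : word (s ++ t) w = word s (word t w).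
Proof. by rewrite /word foldr_cat. Qed.

Lemma bfs_eq i j w z : f i w = f j z -> i = j /\ w = z.
Proof.
have [fI fD _] := fbfs; move=> e.
have ij : i = j by apply: (fD i j) => //; exists (f i w); split; [exists w|exists z].
by split=> //; move: e; rewrite ij => /fI.
Qed.

Lemma bfs_split w : exists i z, w = f i z.
Proof.
have [_ _ fC] := fbfs; have [i _ [z _ <-]] : (\bigcup_i range (f i)) w by rewrite fC.
by exists i, z.
Qed.

Lemma word_inj s : injective (word s).
Proof. by elim: s => [//|i s IH] w z /bfs_eq[_ /IH]. Qed.

(** Ranges of words are nested or disjoint. *)
Lemma word_prefix s t w z : (size s <= size t)%N -> word s w = word t z ->
  exists2 t', t = s ++ t' & w = word t' z.
Proof.
elim: s t => [|i s IH] [|j t] //= st e; [by exists [::]|by exists (j :: t)|].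
have [-> /IH[//|t' -> ->]] := bfs_eq e.
by exists t'.
Qed.

(** Every point has an itinerary: a sequence whose prefixes are words having the
    point in their range. *)
Lemma word_itinerary w : exists r, forall n, exists z, word (mkseq r n) z = w.
Proof.
have /choice[g gP] : forall x, exists iz : 'I_N * W, x = f iz.1 iz.2.
  by move=> x; have [i [z ->]] := bfs_split x; exists (i, z).
pose y n := iter n (fun x => (g x).2) w.
exists (fun n => (g (y n)).1) => n; exists (y n).
elim: n => [//|n IH]; rewrite mkseqS -cats1 word_cat -[RHS]IH; congr word.
by rewrite [RHS]gP.
Qed.

(** Two points are in the same orbit when both are images of a common point under
    words. This relates points whose forward trajectories under the inverse
    branches eventually merge. *)
Definition orbit_eq w z := exists s t x, w = word s x /\ z = word t x.

Lemma orbit_eq_refl w : orbit_eq w w.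
Proof. by exists [::], [::], w. Qed.

Lemma orbit_eq_sym w z : orbit_eq w z -> orbit_eq z w.
Proof. by move=> [s [t [x [-> ->]]]]; exists t, s, x. Qed.

Lemma orbit_eq_trans w y z : orbit_eq w y -> orbit_eq y z -> orbit_eq w z.
Proof.
move=> [s [t [x [-> ->]]]] [s' [t' [x' [e ->]]]].
have [st|/ltnW st] := leqP (size t) (size s').
  have [u _ ->] := word_prefix st e.
  by exists (s ++ u), t', x'; rewrite word_cat.
have [u _ ->] := word_prefix st (esym e).
by exists s, (t' ++ u), x; rewrite word_cat.
Qed.

Lemma orbit_eq_step i w : orbit_eq (f i w) w.
Proof. by exists [:: i], [::], w. Qed.
End bfs_words.

(** * Permutative representations *)

Section permutative_operators.
Context {R : realType} {N : nat} {W : choiceType} (f : 'I_N -> W -> W).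
Hypothesis fbfs : branching_function_system f.
Context {A : cstarAlgType R} (S : 'I_N -> A).
Hypothesis SA : cuntz_algebra S.
Context (pi : representation A (ell2 R W)).
Hypothesis piE : permutative_representation f S pi.
Implicit Types (u v : ell2 R W) (C : set W) (L : set (ell2 R W)).
Local Notation e w := (ell2_basis R (w : W)).

Lemma repr0 v : pi 0 v = 0.
Proof. by have := repr_linear pi (-1) 0 0 v; rewrite scaler0 addr0 scaleN1r addNr. Qed.

Lemma repr_sum (a : 'I_N -> A) v : pi (\sum_i a i) v = \sum_i pi (a i) v.
Proof.
apply: (big_ind2 (fun a u => pi a v = u)) => [|a1 u1 a2 u2 <- <-|//].
  exact: repr0.
by have := repr_linear pi 1 a1 a2 v; rewrite !scale1r.
Qed.

(** The adjoint S_i^* is composition with [f i]. *)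
Lemma star_coord i v w : pi (star (S i)) v w = v (f i w).
Proof.
have h : inner (e w) (pi (star (S i)) v) = inner (e (f i w)) v.
  by rewrite -repr_star piE.
by move: h; rewrite !inner_basis => /(congr1 (@conjc R)); rewrite !conjcK.
Qed.

Lemma gen_coord i j v w : pi (S i) v (f j w) = if i == j then v w else 0.
Proof.
have [isom _ _ _] := SA.
rewrite -star_coord -repr_mul isom eq_sym.
by case: eqP => _; rewrite ?repr_one// repr0.
Qed.

Lemma cuntz_family_repr : cuntz_family (fun i => pi (S i)) (fun i => pi (star (S i))).
Proof.
have [isom rng _ _] := SA; split.
- by move=> i; exact: repr_bounded.
- by move=> i u v; exact: repr_star.
- move=> i j v; rewrite -repr_mul isom.
  by case: eqP => _; rewrite ?repr_one// repr0.
- move=> v; rewrite -[RHS](repr_one pi) -rng repr_sum.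
  by apply: eq_bigr => i _; rewrite repr_mul.
Qed.

Lemma star_basis i w : pi (star (S i)) (e (f i w)) = e w.
Proof.
have [fI _ _] := fbfs.
by apply: ell2P => x; rewrite star_coord !ell2_basisE inj_eq.
Qed.

Section reflection.
Context (C : set W).

(** The diagonal operator with entries 1 on [C] and -1 off [C]. *)
Definition reflection_fun (v : W -> R[i]) w : R[i] := (-1) ^+ (~~ `[< C w >]) * v w.

Lemma reflection_summable v : square_summable (reflection_fun v).
Proof.
have := ell2_summable v; congr (_ < _)%E; apply: eq_esum => w _.
by congr EFin; rewrite sqmodM /reflection_fun; case: asboolP => _;
  rewrite /sqmod /= ?oppr0 ?sqrrN expr0n addr0 expr1n mul1r.
Qed.

Definition reflection v := Ell2 (reflection_summable v).

Lemma reflection_linear : linear reflection.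
Proof.
move=> c u v; apply: ell2P => w.
rewrite -[RHS]/(c * reflection_fun u w + reflection_fun v w).
rewrite -[LHS]/((-1) ^+ (~~ `[< C w >]) * (c * u w + v w)) /reflection_fun; ring.
Qed.

HB.instance Definition _ := GRing.isLinear.Build R[i] (ell2 R W) (ell2 R W) *:%R
  reflection reflection_linear.

Lemma reflectionK : involutive reflection.
Proof.
move=> v; apply: ell2P => w.
rewrite -[LHS]/((-1) ^+ (~~ `[< C w >]) * ((-1) ^+ (~~ `[< C w >]) * v w)).
by rewrite mulrA -expr2 sqrr_sign mul1r.
Qed.

Lemma reflection_adjoint u v : inner (reflection u) v = inner u (reflection v).
Proof.
rewrite -[LHS]/(csum (fun w => reflection_fun u w * (v w)^*%C)).
rewrite -[RHS]/(csum (fun w => u w * (reflection_fun v w)^*%C)).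
congr csum; apply/funext => w; rewrite /reflection_fun rmorphM rmorph_sign; ring.
Qed.

Lemma reflection_continuous : continuous reflection.
Proof.
apply: isometric_continuous => u v; rewrite -linearB.
apply/eqP; rewrite -(@eqrXn2 _ 2)//; apply/eqP.
by rewrite -!innerE reflection_adjoint reflectionK.
Qed.

(** The representations [pi] and reflection o [pi] o reflection agree on the
    generators, hence everywhere. *)
Lemma reflection_comm a v : (forall i w, C (f i w) <-> C w) ->
  pi a (reflection v) = reflection (pi a v).
Proof.
move=> Cinv; have [_ _ _ univ] := SA.
have [pi0 [_ pi0U]] := univ _ _ _ cuntz_family_repr.
pose op a : {linear ell2 R W -> ell2 R W} := reflection \o pi a \o reflection.
have [pi' pi'E] : exists pi' : representation A (ell2 R W),
    forall a v, pi' a v = reflection (pi a (reflection v)).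
  unshelve eexists (@Representation R A _ op _ _ _ _ _) => //.
  - move=> b u.
    have hc : {for u, continuous (pi b \o reflection)}.
      exact: (continuous_comp (@reflection_continuous u)
        (@repr_bounded _ _ _ pi b (reflection u))).
    exact: (continuous_comp hc (@reflection_continuous (pi b (reflection u)))).
  - by move=> c b b' u; rewrite /op /= repr_linear linearP.
  - by move=> b b' u; rewrite /op /= reflectionK repr_mul.
  - by move=> u; rewrite /op /= repr_one reflectionK.
  - by move=> b u v'; rewrite /op /= reflection_adjoint repr_star reflection_adjoint.
have pi'S i u : pi' (S i) u = pi (S i) u.
  rewrite pi'E; apply: ell2P => w; have [j [x ->]] := bfs_split fbfs w.
  rewrite -[LHS]/((-1) ^+ (~~ `[< C (f j x) >]) * pi (S i) (reflection u) (f j x)).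
  rewrite !gen_coord; case: eqP => _; last by rewrite mulr0.
  rewrite -[reflection u x]/((-1) ^+ (~~ `[< C x >]) * u x).
  by rewrite (propext (Cinv j x)) mulrA -expr2 sqrr_sign mul1r.
have piS i u : pi (S i) u = pi (S i) u by [].
by rewrite -[LHS]reflectionK -pi'E (pi0U _ pi'S) -(pi0U _ piS).
Qed.

Lemma ell2_sub_invariant : (forall i w, C (f i w) <-> C w) ->
  closed_invariant_subspace pi (ell2_sub C).
Proof.
move=> Cinv; split.
  have -> : @ell2_sub R W C = [set v | forall w, ~ C w -> v w = 0].
    by apply/seteqP; split => v /ell2_subP.
  exact: closed_subspace_supp.
move=> a v /ell2_subP vC; apply/ell2_subP => w Cw.
have vE : reflection v = v.
  apply: ell2P => x; rewrite -[LHS]/((-1) ^+ (~~ `[< C x >]) * v x).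
  by case: asboolP => [_|/vC ->]; rewrite ?mul1r ?mulr0.
have := congr1 (fun u : ell2 R W => u w) (reflection_comm a v Cinv).
rewrite vE -[RHS]/((-1) ^+ (~~ `[< C w >]) * pi a v w).
case: asboolP => //= _ /eqP; rewrite mulN1r -subr_eq0 opprK -mulr2n.
by rewrite mulrn_eq0 => /eqP.
Qed.
End reflection.

(** [word_proj s] is the range projection S_s S_s^* of the word [s]. *)
Fixpoint word_proj (s : seq 'I_N) v : ell2 R W :=
  if s is i :: t then pi (S i) (word_proj t (pi (star (S i)) v)) else v.

Lemma word_projE s v w : word_proj s v (word f s w) = v (word f s w).
Proof. by elim: s v w => [//|i s IH] v w /=; rewrite gen_coord eqxx IH star_coord. Qed.

Lemma word_projN s v w : ~ range (word f s) w -> word_proj s v w = 0.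
Proof.
elim: s v w => [|i s IH] v w; first by case; exists w.
have [j [x ->]] := bfs_split fbfs w => jx /=; rewrite gen_coord.
case: eqP => // ij; apply: IH => -[z _ zx]; apply: jx; exists z => //=.
by rewrite -zx ij.
Qed.

Lemma word_proj_invariant L s v : closed_invariant_subspace pi L ->
  L v -> L (word_proj s v).
Proof.
move=> [_ LA]; elim: s v => [//|i s IH] v Lv /=.
by apply/LA/IH/LA.
Qed.

Lemma word_basis_invariant L s w : closed_invariant_subspace pi L ->
  L (e (word f s w)) <-> L (e w).
Proof.
move=> [_ LA]; elim: s => [//|i s <-] /=; split => [|Lw].
  by move=> /(LA (star (S i))); rewrite star_basis.
by rewrite -piE; apply: LA.
Qed.

(** If [y] is the only point with the itinerary [r], a closed invariant subspace
    that contains [v] contains the component of [v] along [e y]. *)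
Lemma coord_basis_in L r v y : closed_invariant_subspace pi L ->
  (forall n, exists z, word f (mkseq r n) z = y) ->
  (forall x, (forall n, exists z, word f (mkseq r n) z = x) -> x = y) ->
  L v -> L (v y *: e y).
Proof.
move=> hL ry rinj Lv; have [[cL _ _] _] := hL.
have decr m n x : (m <= n)%N ->
    range (word f (mkseq r n)) x -> range (word f (mkseq r m)) x.
  move=> mn [z _ <-]; rewrite -(subnKC mn).
  rewrite /mkseq iotaD map_cat word_cat.
  by eexists.
apply: (@closed_dominated _ _ L _ v) => // X fX.
(* finitely many points other than [y] leave the nested cylinders of [r] *)
have /(_ (fset_set X))[n nP] : forall s : seq W, exists n, forall x, x \in s ->
    x != y -> ~ range (word f (mkseq r n)) x.
  elim=> [|x s [n nP]]; first by exists 0%N.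
  have [->|xy] := eqVneq x y.
    exists n => z; rewrite inE => /orP[/eqP ->|]; first by rewrite eqxx.
    exact: nP.
  have [m mP] : exists m, ~ range (word f (mkseq r m)) x.
    apply/existsNP => h; case/eqP: xy; apply: rinj => n'.
    by have [z _ zx] := h n'; exists z.
  exists (maxn m n) => z; rewrite inE => /orP[/eqP -> _|zs zy].
    by move/(decr _ _ _ (leq_maxl m n)).
  by move/(decr _ _ _ (leq_maxr m n)); exact: nP.
exists (word_proj (mkseq r n) v); first exact: word_proj_invariant.
have coordE x : (v y *: e y) x = v y * (x == y)%:R by [].
have yE : word_proj (mkseq r n) v y = v y.
  by have [z <-] := ry n; rewrite word_projE.
split=> [x Xx|x]; rewrite coordE; have [->|xy] := eqVneq x y; rewrite ?mulr1 ?mulr0.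
- exact: yE.
- by apply/word_projN/nP => //; rewrite in_fset_set// mem_set.
- by rewrite yE subrr {1}/sqmod /= expr0n addr0 sqmod_ge0.
- have [[z _ <-]|/(word_projN v) ->] := pselect (range (word f (mkseq r n)) x).
    by rewrite word_projE sub0r /sqmod; case: (v _) => a b /=; rewrite !sqrrN.
  by rewrite subr0 {1}/sqmod /= expr0n addr0 sqmod_ge0.
Qed.

(** When points are separated by their itineraries, the orbits of a branching
    function system give the irreducible decomposition. *)
Lemma orbit_decomposition :
  (forall r x y, (forall n, exists z, word f (mkseq r n) z = x) ->
     (forall n, exists z, word f (mkseq r n) z = y) -> x = y) ->
  irreducible_decomposition pi (range (fun x => [set y | orbit_eq f y x]))
    (fun C => ell2_sub C).
Proof.
move=> sep; split.
- move=> _ [x _ <-]; apply: ell2_sub_invariant => i w /=.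
  split=> h; apply: orbit_eq_trans h => //; last exact: orbit_eq_step.
  by apply: orbit_eq_sym; exact: orbit_eq_step.
- move=> _ [x _ <-] L hL LK; have [hL1 _] := hL; have [cL L0 _] := hL1.
  have [|nz] := pselect (L `<=` [set 0]).
    by move=> L00; left; apply/seteqP; split => // _ ->.
  right; apply/seteqP; split => // u /ell2_subP.
  have [v Lv v0] : exists2 v, L v & v <> 0.
    apply: contrapT => h; apply: nz => v Lv.
    by apply: contrapT => v0; apply: h; exists v.
  have [y vy] : exists y, v y <> 0.
    apply: contrapT => h; apply: v0; apply: ell2P => y.
    by apply: contrapT => vy; apply: h; exists y.
  have yx : orbit_eq f y x.
    by apply: contrapT => yx; apply: vy; apply: (iffLR (ell2_subP _ _) (LK v Lv)).
  have Ly : L (e y).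
    have [r ry] := word_itinerary fbfs y.
    have [_ LZ] := closed_subspace_stable hL1.
    have := LZ (v y)^-1 _ (coord_basis_in hL ry (fun x xr => sep r x y xr ry) Lv).
    by rewrite scalerA mulVf ?scale1r//; apply/eqP.
  apply: closed_subspace_full => // z zx.
  have [s [t [w [zE yE]]]] := orbit_eq_trans fbfs zx (orbit_eq_sym yx).
  rewrite zE; apply/(word_basis_invariant s w hL).
  by apply/(word_basis_invariant t w hL); rewrite -yE.
- move=> _ _ [x _ <-] [y _ <-] xy u v /ell2_subP hu /ell2_subP hv.
  apply: inner_disjoint => w.
  have [wx|/hu] := pselect (orbit_eq f w x); last by left.
  right; apply: hv => wy; apply: xy; apply/seteqP.
  have xy' := orbit_eq_trans fbfs (orbit_eq_sym wx) wy.
  split=> z zh; apply: (orbit_eq_trans fbfs zh) => //; exact: orbit_eq_sym.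
- apply/seteqP; split => // v _ L [hL hs].
  apply: (@closed_subspace_full _ _ L setT) => // w; last by case.
move=> _.
  apply: hs; exists [set y | orbit_eq f y w]; first by exists w.
  apply/ell2_subP => x xw; rewrite ell2_basisE; case: eqP => // xE.
  by case: xw; rewrite xE; exact: orbit_eq_refl.
Qed.
End permutative_operators.

(** * Unimodular fractional linear maps of the unit interval *)

Section unimodular_fractions.
Context {R : realType}.
Implicit Types (g k : R -> R) (x y : R).

(** [g] is, on [0, 1], the fractional linear map in PGL_2(Z) that sends 0 to
    [p0 / u] and 1 to [p1 / v]; [u] and [v] are the positive denominators
    of the images of the endpoints. *)
Definition fraction_map (p0 p1 u v : int) g :=
  [/\ 0 < u, 0 < v, `|p0 * v - p1 * u| = 1 &
    forall x, x \in `[0, 1] ->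
      g x = (p0%:~R * (1 - x) + p1%:~R * x) / (u%:~R * (1 - x) + v%:~R * x)].

Lemma mem01 : ((0 : R) \in `[0, 1]) * ((1 : R) \in `[0, 1]).
Proof. by rewrite !in_itv /= !lexx ler01. Qed.

Lemma fraction_den_gt0 (u v : int) x : 0 < u -> 0 < v -> x \in `[0, 1] ->
  0 < u%:~R * (1 - x) + v%:~R * x.
Proof.
rewrite in_itv /= => u0 v0 /andP[x0 x1].
have u1 : 0 < u%:~R :> R by rewrite ltr0z.
have v1 : 0 < v%:~R :> R by rewrite ltr0z.
have [->|xn0] := eqVneq x 0; first by rewrite subr0 mulr1 mulr0 addr0.
apply: ltr_wpDl; first by rewrite mulr_ge0 ?subr_ge0// ltW.
by rewrite mulr_gt0// lt_def xn0.
Qed.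

Lemma fraction_map_id : fraction_map 0 1 1 1 id.
Proof.
split=> // x _; by rewrite mulr0z mulr1z mul0r add0r !mul1r subrK divr1.
Qed.

Lemma PGL2Z_fraction g : PGL2Z_on01 g ->
  exists p0 p1 u v, fraction_map p0 p1 u v g.
Proof.
move=> [M dM gM]; move: dM; rewrite det_mx2.
move: (M 0 0) (M 0 1) (M 1 0) (M 1 1) gM => a b c d gM dM.
have d0 : d != 0.
  by have [] := gM 0 mem01.1; rewrite mulr0 add0r intr_eq0.
have cd0 : c + d != 0.
  by have [] := gM 1 mem01.2; rewrite mulr1 -rmorphD intr_eq0.
(* otherwise the denominator vanishes at x = - d / c *)
have dcd : 0 < d * (c + d).
  rewrite lt_def mulf_neq0//= leNgt; apply/negP => neg.
  have c0 : c != 0 by apply: contraTneq neg => ->; rewrite -leNgt add0r -expr2 sqr_ge0.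
  have cR0 : c%:~R != 0 :> R by rewrite intr_eq0.
  have negR : d%:~R * (c%:~R + d%:~R) < 0 :> R by rewrite -rmorphD -rmorphM ltrz0.
  have /gM[] : - d%:~R / c%:~R \in `[0 : R, 1]; last first.
    by rewrite mulrC mulfVK// addNr eqxx.
  have c2 : 0 < c%:~R ^+ 2 :> R by rewrite exprn_even_gt0.
  rewrite in_itv /=; apply/andP; split.
    rewrite -(ler_pM2r c2) mul0r (_ : _ * _ ^+ 2 = - d%:~R * c%:~R); last by field.
    by have := sqr_ge0 (d%:~R : R); nra.
  rewrite -(ler_pM2r c2) mul1r (_ : _ * _ ^+ 2 = - d%:~R * c%:~R); last by field.
  by have := sqr_ge0 (c%:~R + d%:~R : R); nra.
have [dp|dn] := ltP 0 d.
  exists b, (a + b), d, (c + d); split => //.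
  - by rewrite -(pmulr_rgt0 _ dp).
  - by rewrite -normrN -dM; congr `|_|; ring.
  - by move=> x /gM[_ ->]; rewrite !rmorphD/=; congr (_ / _); ring.
have {}dn : 0 < - d by rewrite oppr_gt0 lt_def eq_sym d0.
exists (- b), (- (a + b)), (- d), (- (c + d)); split => //.
- by rewrite -(pmulr_rgt0 _ dn) mulrNN.
- by rewrite -normrN -dM; congr `|_|; ring.
- move=> x /gM[_ ->]; rewrite !rmorphN !rmorphD/= !mulNr -!opprD invrN mulrNN.
  by congr (_ / _); ring.
Qed.

Lemma fraction_ends p0 p1 u v g : fraction_map p0 p1 u v g ->
  (forall x, x \in `[0, 1] -> g x \in `[0, 1]) ->
  [/\ 0 <= p0, p0 <= u, 0 <= p1 & p1 <= v].
Proof.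
move=> [u0 v0 _ gE] g01.
have u1 : 0 < u%:~R :> R by rewrite ltr0z.
have v1 : 0 < v%:~R :> R by rewrite ltr0z.
have := g01 _ mem01.1; have := g01 _ mem01.2; rewrite (gE _ mem01.1) (gE _ mem01.2).
rewrite subrr subr0 !mulr1 !mulr0 !addr0 !add0r !in_itv /=.
rewrite !ler_pdivlMr// !ler_pdivrMr// !mul0r !mul1r !ler0z !ler_int.
by move=> /andP[-> ->] /andP[-> ->].
Qed.

(** The new endpoint data is the old one times a nonnegative integer matrix of
    determinant 1 or -1. *)
Lemma fraction_map_comp p0 p1 u v g b0 b1 d0 d1 k :
  fraction_map p0 p1 u v g -> fraction_map b0 b1 d0 d1 k ->
  (forall x, x \in `[0, 1] -> k x \in `[0, 1]) ->
  fraction_map (p0 * (d0 - b0) + p1 * b0) (p0 * (d1 - b1) + p1 * b1)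
    (u * (d0 - b0) + v * b0) (u * (d1 - b1) + v * b1) (g \o k).
Proof.
move=> hg hk k01; have [b00 bd0 b10 bd1] := fraction_ends hk k01.
have [u0 v0 pE gE] := hg; have [d00 d10 bE kE] := hk.
have pos b d : 0 <= b -> b <= d -> 0 < d -> 0 < u * (d - b) + v * b.
  by move=> ? ? ?; nia.
split.
- exact: pos.
- exact: pos.
- have -> : (p0 * (d0 - b0) + p1 * b0) * (u * (d1 - b1) + v * b1) -
      (p0 * (d1 - b1) + p1 * b1) * (u * (d0 - b0) + v * b0) =
      - ((p0 * v - p1 * u) * (b0 * d1 - b1 * d0)) by ring.
  by rewrite normrN normrM pE bE.
- move=> x x01 /=; rewrite gE ?k01//.
  have := fraction_den_gt0 u0 v0 (k01 _ x01); rewrite kE//.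
  have := fraction_den_gt0 d00 d10 x01.
  have := fraction_den_gt0 (pos _ _ b00 bd0 d00) (pos _ _ b10 bd1 d10) x01.
  rewrite !rmorphD !rmorphM !rmorphB/=.
  by move=> h1 h2 h3; field; rewrite !gt_eqF.
Qed.

(** A fraction map that does not cover [0, 1] has an endpoint denominator
    larger than 1: otherwise it sends x to x or to 1 - x. *)
Lemma fraction_den_ge3 p0 p1 u v g : fraction_map p0 p1 u v g ->
  (forall x, x \in `[0, 1] -> g x \in `[0, 1]) ->
  ~ (`[0, 1]%classic `<=` g @` `[0, 1]%classic) -> 3 <= u + v.
Proof.
move=> hg g01 nsurj; have [p00 pu p10 pv] := fraction_ends hg g01.
have [u0 v0 pE gE] := hg; rewrite leNgt; apply/negP => uv.
apply: nsurj => y /= y01.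
have [u1 v1] : u = 1 /\ v = 1 by lia.
move: pu pv pE gE; rewrite u1 v1 => pu pv pE gE.
have [[p0E p1E]|[p0E p1E]] : (p0 = 0 /\ p1 = 1) \/ (p0 = 1 /\ p1 = 0) by lia.
  exists y => //; rewrite gE// p0E p1E mulr0z mulr1z.
  by rewrite mul0r add0r !mul1r subrK divr1.
have y01' : 1 - y \in `[0, 1] by move: y01; rewrite !in_itv /=; lra.
exists (1 - y) => //; rewrite gE// p0E p1E mulr0z mulr1z.
by rewrite mul0r addr0 !mul1r subrK divr1 opprB addrCA subrr addr0.
Qed.

Lemma fraction_den_growth p0 p1 u v g b0 b1 d0 d1 k :
  fraction_map p0 p1 u v g -> fraction_map b0 b1 d0 d1 k ->
  (forall x, x \in `[0, 1] -> k x \in `[0, 1]) -> 3 <= d0 + d1 ->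
  u + v + 1 <= (u * (d0 - b0) + v * b0) + (u * (d1 - b1) + v * b1).
Proof.
move=> [u0 v0 _ _] hk k01 d3; have [b00 bd0 b10 bd1] := fraction_ends hk k01.
have [d00 d10 bE _] := hk.
(* a vanishing row would make the determinant zero *)
have b1p : 1 <= b0 + b1.
  rewrite leNgt; apply/negP => h; have [b0E b1E] : b0 = 0 /\ b1 = 0 by lia.
  by move: bE; rewrite b0E b1E !mul0r subrr normr0.
have d1p : 1 <= (d0 - b0) + (d1 - b1).
  rewrite leNgt; apply/negP => h; have [b0E b1E] : b0 = d0 /\ b1 = d1 by lia.
  by move: bE; rewrite b0E b1E (mulrC d1) subrr normr0.
have -> : u * (d0 - b0) + v * b0 + (u * (d1 - b1) + v * b1) =
  u * (d0 - b0 + (d1 - b1)) + v * (b0 + b1) by ring.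
have : 3 <= (d0 - b0 + (d1 - b1)) + (b0 + b1) by lia.
move: (d0 - b0 + _) (b0 + b1) b1p d1p => m n; nia.
Qed.

(** The image of [0, 1] has length 1 / (u v), and u v >= u + v - 1. The factor 2
    comes from comparing both points with the image of 0. *)
Lemma fraction_map_contract p0 p1 u v g x y : fraction_map p0 p1 u v g ->
  x \in `[0, 1] -> y \in `[0, 1] -> `|g x - g y| * (u + v - 1)%:~R <= 2.
Proof.
move=> [u0 v0 pE gE] x01 y01.
have u1 : 0 < u%:~R :> R by rewrite ltr0z.
have v1 : 0 < v%:~R :> R by rewrite ltr0z.
have near0 z : z \in `[0, 1] -> `|g z - p0%:~R / u%:~R| * (u%:~R * v%:~R) <= 1.
  move=> z01; have Dp := fraction_den_gt0 u0 v0 z01.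
  have pER : `|p1%:~R * u%:~R - p0%:~R * v%:~R| = 1 :> R.
    by rewrite distrC -!rmorphM -rmorphB -intr_norm pE.
  rewrite gE// (_ : _ - _ = (p1%:~R * u%:~R - p0%:~R * v%:~R) *
    (z / (u%:~R * (u%:~R * (1 - z) + v%:~R * z)))); last first.
    by field; rewrite !gt_eqF.
  move: z01; rewrite in_itv /= => /andP[z0 z1].
  rewrite normrM pER mul1r ger0_norm; last first.
    by rewrite divr_ge0// mulr_ge0// ltW.
  rewrite [leLHS](_ : _ = v%:~R * z / (u%:~R * (1 - z) + v%:~R * z)); last first.
    by field; rewrite !gt_eqF.
  by rewrite ler_pdivrMr// mul1r lerDr mulr_ge0 ?subr_ge0// ltW.
have uv : (u + v - 1)%:~R <= u%:~R * v%:~R :> R.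
  by rewrite -rmorphM ler_int; nia.
apply: (le_trans (ler_wpM2l (normr_ge0 _) uv)).
have -> : g x - g y = (g x - p0%:~R / u%:~R) - (g y - p0%:~R / u%:~R) by ring.
have := ler_normB (g x - p0%:~R / u%:~R) (g y - p0%:~R / u%:~R).
have uv0 : 0 <= u%:~R * v%:~R :> R by rewrite mulr_ge0// ltW.
move=> /(ler_wpM2r uv0) /le_trans; apply; rewrite mulrDl.
by have := lerD (near0 _ x01) (near0 _ y01).
Qed.
End unimodular_fractions.

(** * Itineraries of slow continued fraction algorithms *)

Section scfa_itineraries.
Context {R : realType} {N : nat} {h : 'I_N -> R -> R}.
Hypothesis hscfa : slow_cfa h.
Implicit Types (s t : nat -> 'I_N) (w z : irr01 R) (x y : R).
Local Notation f := (scfa_bfs hscfa).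

Lemma scfa_maps01 i x : x \in `[0, 1] -> h i x \in `[0, 1].
Proof.
move=> x01; have [_ Jc _] := scfa_partition hscfa.
by suff : `[0, 1]%classic (h i x) by []; rewrite -Jc; exists i => //; exists x.
Qed.

(** There is a second nondegenerate interval, which the image of [h i] meets in at
    most one point. *)
Lemma scfa_not_onto i : ~ (`[0, 1]%classic `<=` h i @` `[0, 1]%classic).
Proof.
move=> sub; have [Ju Jc J1] := scfa_partition hscfa.
have [j ji] : exists j, j != i.
  have N2 := scfa_ge2 hscfa.
  have [->|i0] := eqVneq i (Ordinal (ltnW N2)); first by exists (Ordinal N2).
  by exists (Ordinal (ltnW N2)); rewrite eq_sym.
have [p [q [p' [q' [[q0 q'0] _ det Jj J01]]]]] := Ju j.
have qR : 0 < q%:~R :> R by rewrite ltr0z.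
have q'R : 0 < q'%:~R :> R by rewrite ltr0z.
have detR : p%:~R * q'%:~R - p'%:~R * q%:~R = -1 :> R.
  by rewrite -!rmorphM -rmorphB det.
have lt : p%:~R / q%:~R < p'%:~R / q'%:~R :> R.
  by rewrite ltr_pdivrMr// mulrAC ltr_pdivlMr//; lra.
have inJ (y : R) : y \in `[p%:~R / q%:~R, p'%:~R / q'%:~R] ->
    ((h j @` `[0, 1]%classic) `&` (h i @` `[0, 1]%classic)) y.
  move=> yJ; have jy : (h j @` `[0, 1]%classic) y by rewrite Jj.
  by split => //; apply/sub/J01.
have := J1 j i ji _ _ (inJ (p%:~R / q%:~R) _) (inJ (p'%:~R / q'%:~R) _).
rewrite !in_itv /= !lexx (ltW lt) => /(_ isT isT) e.
by rewrite e ltxx in lt.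
Qed.

Lemma word_map_fraction s n : exists p0 p1 u v,
  fraction_map p0 p1 u v (word_map h s n) /\ n%:Z + 2 <= u + v.
Proof.
elim: n => [|n [p0 [p1 [u [v [gE uv]]]]]].
  by exists 0, 1, 1, 1; split => //; exact: fraction_map_id.
have [b0 [b1 [d0 [d1 kE]]]] := PGL2Z_fraction (scfa_PGL2Z hscfa (s n)).
have k01 := @scfa_maps01 (s n).
do 4 eexists; split; first exact: fraction_map_comp gE kE k01.
have d3 := fraction_den_ge3 kE k01 (@scfa_not_onto (s n)).
by have := fraction_den_growth gE kE k01 d3; lia.
Qed.

(** Each letter raises the sum of the endpoint denominators, so the nested images
    shrink to a point. *)
Lemma itinerary_inj s x y : itinerary h s x -> itinerary h s y -> x = y.
Proof.
move=> sx sy; apply/eqP; rewrite -subr_eq0 -normr_eq0 eq_le normr_ge0 andbT.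
apply/ler_addgt0Pr => d d0; rewrite add0r.
have [n nd] : exists n : nat, 2 / d < n%:R.
  exists (Num.truncn (2 / d)).+1; exact: truncnS_gt.
have [p0 [p1 [u [v [gE uv]]]]] := word_map_fraction s n.+1.
have [x' x01 <-] := sx n.+1 isT; have [y' y01 <-] := sy n.+1 isT.
have := fraction_map_contract gE x01 y01.
have uvR : n%:R <= (u + v - 1)%:~R :> R by rewrite -[n%:R]/(n%:~R) ler_int; lia.
move=> /(le_trans (ler_wpM2l (normr_ge0 _) uvR)) le2.
have n0 : 0 < n%:R :> R by apply: lt_trans nd; rewrite divr_gt0.
rewrite -(ler_pM2r n0); apply: le_trans le2 _.
by move: nd; rewrite ltr_pdivrMr// mulrC => /ltW.
Qed.

Lemma word_mapE s n z : word_map h s n (val z) = val (word f (mkseq s n) z).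
Proof.
elim: n z => [//|n IH] z; rewrite mkseqS -cats1 word_cat -IH.
by [].
Qed.

Lemma word_map_irr s n x : x \in `[0, 1] -> irrational (word_map h s n x) ->
  irrational x.
Proof.
elim: n x => [//|n IH] x x01 /(IH _ (scfa_maps01 _ x01)) hirr xrat; apply: hirr.
have [M _ Mx] := scfa_PGL2Z hscfa (s n); have [_ ->] := Mx x x01.
by apply: rational_div; apply: rational_lin.
Qed.

(** For an irrational point the itinerary in the sense of the closed intervals is
    the itinerary in the branching function system, since a preimage of an
    irrational point is irrational. *)
Lemma itineraryP s w :
  itinerary h s (val w) <-> forall n, exists z, word f (mkseq s n) z = w.
Proof.
have [_ wirr] := set_mem (valP w).
split=> [sw [|n]|sw n _].
- by exists w.
- have [x x01 xw] := sw n.+1 isT.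
  have xirr : x \in irr01 R.
    apply/mem_set; split => //; apply: (@word_map_irr s n.+1) => //.
    by rewrite xw.
  by exists (exist _ x xirr); apply/val_inj; rewrite -word_mapE.
- have [z <-] := sw n; exists (val z); last exact: word_mapE.
  by have [] := set_mem (valP z).
Qed.

Lemma word_separates s w z : (forall n, exists w', word f (mkseq s n) w' = w) ->
  (forall n, exists w', word f (mkseq s n) w' = z) -> w = z.
Proof.
by move=> /itineraryP sw /itineraryP sz; apply/val_inj/(itinerary_inj sw sz).
Qed.

(** The infinite sequence [a] followed by [r]. *)
Definition prepend (a : seq 'I_N) (r : nat -> 'I_N) (n : nat) :=
  nth (r (n - size a)%N) a n.

Lemma prepend_itinerary a r w : itinerary h r (val w) ->
  itinerary h (prepend a r) (val (word f a w)).
Proof.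
move=> /itineraryP rw; apply/itineraryP => n.
have [na|an] := leqP n (size a).
  exists (word f (drop n a) w); rewrite -word_cat; congr word.
  rewrite -[RHS](cat_take_drop n); congr cat.
  case: n na => [|n] na; first by rewrite take0.
  have x0 := r 0%N.
  apply: (@eq_from_nth _ x0); rewrite size_mkseq ?size_takel// => i ia.
  by rewrite nth_mkseq// nth_take// /prepend (set_nth_default x0)// (leq_trans ia).
have [z <-] := rw (n - size a)%N; exists z.
rewrite -word_cat; congr word.
have x0 := r 0%N; apply: (@eq_from_nth _ x0).
  by rewrite size_cat !size_mkseq subnKC// ltnW.
move=> i; rewrite size_mkseq => ia; rewrite nth_mkseq// nth_cat /prepend.
have [ia'|ia'] := ltnP i (size a); first exact: set_nth_default.
by rewrite nth_default// nth_mkseq// ltn_sub2r// (leq_ltn_trans ia').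
Qed.

Lemma itinerary_shift m s z :
  itinerary h s (val (word f (mkseq s m) z)) ->
  itinerary h (fun n => s (m + n)%N) (val z).
Proof.
move=> /itineraryP sz; apply/itineraryP => n.
have [x] := sz (m + n)%N.
rewrite /mkseq iotaD map_cat word_cat => /(word_inj (scfa_bfsP hscfa)) <-.
exists x; congr word.
by rewrite add0n -[in RHS](addn0 m) iotaDl -map_comp.
Qed.

(** On irrational points, tail equivalence of itineraries means lying in the
    same orbit of the branching function system. *)
Lemma orbit_relP w z : orbit_rel h (val w) (val z) <-> orbit_eq f w z.
Proof.
split=> [[s [t [sw tz [k [m H]]]]]|[a [b [x [-> ->]]]]].
  have [l lE _] := H m (leqnn m).
  have [w' w'E] := (itineraryP s w).1 sw l.
  have [z' z'E] := (itineraryP t z).1 tz m.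
  have -> : w = word f (mkseq s l) w' by rewrite w'E.
  exists (mkseq s l), (mkseq t m), w'; split => //; rewrite -z'E; congr word.
  rewrite -w'E in sw; rewrite -z'E in tz.
  have := itinerary_shift tz; have := itinerary_shift sw.
  have -> : (fun n => t (m + n)%N) = (fun n => s (l + n)%N).
    apply/funext => n; have [l' l'E <-] := H (m + n)%N (leq_addr n m).
    by congr s; lia.
  by move=> w's z's; apply/val_inj; apply: itinerary_inj z's w's.
have [r /itineraryP rx] := word_itinerary (scfa_bfsP hscfa) x.
exists (prepend a r), (prepend b r); split; try exact: prepend_itinerary.
exists ((size a)%:Z - (size b)%:Z), (size b) => n bn.
exists (n - size b + size a)%N; first by lia.
by rewrite /prepend !nth_default// ?leq_addl// addnK.
Qed.

Lemma orbit_spaceE : orbit_space h = range (fun w => [set z | orbit_eq f z w]).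
Proof.
rewrite /orbit_space; congr (_ @` _); apply/funext => w.
by apply/seteqP; split=> z /(orbit_relP z w).
Qed.
End scfa_itineraries.

Theorem proposition6p1 (R : realType) (N : nat)
  (h : 'I_N -> R -> R) (hscfa : slow_cfa h)
  (O : cstarAlgType R) (S : 'I_N -> O) (hO : cuntz_algebra S)
  (pi_F : representation O (ell2 R (irr01 R)))
  (hpi : permutative_representation (scfa_bfs hscfa) S pi_F) :
  irreducible_decomposition pi_F (orbit_space h)
    (fun C : set (irr01 R) => ell2_sub C).
Proof.
rewrite (orbit_spaceE hscfa).
apply: (orbit_decomposition (scfa_bfsP hscfa) hO hpi) => r x y.
exact: word_separates.
Qed.
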